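(* Assume: (A1) for each $j\in N$: (i) there exists $x^{s,*}_j$ with $f_j(x^{s,*}_j,0)=0$; (ii) for every constant $\bar\omega_j\in\mathbb{R}$, every compact invariant set of $\dot x^s_j=f_j(x^s_j,-\bar\omega_j)$ consists only of equilibrium points; (A2) there exists at least one bus $j\in N$ such that whenever $f_j(\bar x^s_j,-\bar\omega_j)=0$ for constants $\bar x^s_j,\bar\omega_j$, then $\bar\omega_j=0$. Let $x^*=(\eta^*,\omega^*,x^{s,*})$ be an equilibrium of $\dot x\in Q(x)$ (so $0_n\in Q(x^* )$; then $\omega^*=0$) such that (A3) for each $j\in N$, the system $\dot x^s_j=f_j(x^s_j,u)$, $s_j=g_j(x^s_j,u)$ (input $u=-\omega_j$) is locally input strictly passive around the input $u=0$ and the point $x^{s,*}_j$, with a storage function $V^S_j$ that has a strict local minimum at $x^{s,*}_j$; (A4) $|\eta^*_{ij}|<\pi/2$ for all $(i,j)\in E$. Then there exists an open neighborhood $\Xi$ of $x^*$ such that every Filippov solution $x=(\eta,\omega,x^s):[0,\infty)\to\mathbb{R}^n$ of $\dot x\in Q(x)$ with $x(0)\in\Xi$ converges to the set of equilibria of $\dot x\in Q(x)$; in particular $\omega(t)\to 0_{|N|}$.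
   Context: Network model. $(N,E)$ is a connected directed graph with $N=\{1,\dots,|N|\}$, $E\subseteq N\times N$, with arbitrary orientation: if $(i,j)\in E$ then $(j,i)\notin E$. For $j\in N$, ''$i:i\to j$'' ranges over $i$ with $(i,j)\in E$ and ''$k:j\to k$'' over $k$ with $(j,k)\in E$. Constants: $M_j>0$, $p^L_j\in\mathbb{R}$ ($j\in N$), $B_{ij}>0$ ($(i,j)\in E$). States: $\eta_{ij}\in\mathbb{R}$ for $(i,j)\in E$, $\omega_j\in\mathbb{R}$ and $x^s_j\in\mathbb{R}^{n_j}$ for $j\in N$; the full state is $x=(\eta,\omega,x^s)\in\mathbb{R}^n$, $n=|E|+|N|+\sum_j n_j$. The dynamics are $\dot\eta_{ij}=\omega_i-\omega_j$, $(i,j)\in E$; $M_j\dot\omega_j=-p^L_j+s_j-d^c_j-\sum_{k:j\to k}p_{jk}+\sum_{i:i\to j}p_{ij}$, $j\in N$; $p_{ij}=B_{ij}\sin\eta_{ij}$; $\dot x^s_j=f_j(x^s_j,-\omega_j)$, $s_j=g_j(x^s_j,-\omega_j)$, where $f_j:\mathbb{R}^{n_j}\times\mathbb{R}\to\mathbb{R}^{n_j}$ and $g_j:\mathbb{R}^{n_j}\times\mathbb{R}\to\mathbb{R}$ are globally Lipschitz. On-off loads. For each $j$, constants $-\infty<\underline d_j\le 0\le\overline d_j<\infty$ and $\underline\omega_j<0<\overline\omega_j$ are given, and $d^c_j=f^c_j(\omega_j)$ where $f^c_j(\omega)=\overline d_j$ if $\omega>\overline\omega_j$, $=0$ if $\underline\omega_j<\omega\le\overline\omega_j$,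 $=\underline d_j$ if $\omega\le\underline\omega_j$. Its Filippov set-valued map is $F[d^c_j](\omega)=[0,\overline d_j]$ if $\omega=\overline\omega_j$, $[\underline d_j,0]$ if $\omega=\underline\omega_j$, and $\{f^c_j(\omega)\}$ otherwise. The set-valued map $Q(x)$ has components: $\{\omega_i-\omega_j\}$ for each $(i,j)\in E$; $\{\frac1{M_j}(-p^L_j+s_j-v_j-\sum_{k:j\to k}p_{jk}+\sum_{i:i\to j}p_{ij}): v_j\in F[d^c_j](\omega_j)\}$ for each $j\in N$; $\{f_j(x^s_j,-\omega_j)\}$ for each $j\in N$. A Filippov solution on an interval $I$ is an absolutely continuous map $x$ with $\dot x(t)\in Q(x(t))$ for almost all $t\in I$. A point $x^*$ is an equilibrium if $0_n\in Q(x^* )$. Passivity. The system $\dot x^s_j=f_j(x^s_j,u)$, $s_j=g_j(x^s_j,u)$ is locally input strictly passive around the constant input $\bar u$ and point $\bar x^s_j$ if there exist open neighborhoods $\Omega_j$ of $\bar u$ and $X^s_j$ of $\bar x^s_j$, a continuously differentiable positive semidefinite function $V^S_j:\mathbb{R}^{n_j}\to\mathbb{R}$ (storage function) and a positive definite function $\phi_j:\mathbb{R}\to\mathbb{R}$ such that for all $u\in\Omega_j$ and $x^s_j\in X^s_j$: $\frac{\partial V^S_j}{\partial x^s_j}(x^s_j)\,f_j(x^s_j,u)\le (u-\bar u)(g_j(x^s_j,u)-\bar s_j)-\phi_j(u-\bar u)$, where $\bar s_j=g_j(\bar x^s_j,\bar u)$. *)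

(* Defs.v *)
From Stdlib Require Import Reals Lra List Arith.
Import ListNotations.
Open Scope R_scope.

(** * Vectors of R^n are represented as [nat -> R]; only components [i < n] matter. *)
Definition vec := nat -> R.

Definition sumR (l : list R) : R := fold_right Rplus 0 l.

Definition sum_lt (n : nat) (F : nat -> R) : R := sumR (map F (seq 0 n)).

Definition vsub (v w : vec) : vec := fun i => v i - w i.
Definition vadd (v w : vec) : vec := fun i => v i + w i.

Definition vnorm (n : nat) (v : vec) : R := sum_lt n (fun i => Rabs (v i)).

Definition openR (O : R -> Prop) : Prop :=
  forall x, O x -> exists d, 0 < d /\ forall y, Rabs (y - x) < d -> O y.
Definition openV (n : nat) (O : vec -> Prop) : Prop :=
  forall x, O x -> exists d, 0 < d /\ forall y, vnorm n (vsub y x) < d -> O y.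

(** compact subset of R^n (closed and bounded, Heine-Borel) *)
Definition compactV (n : nat) (S : vec -> Prop) : Prop :=
  openV n (fun x => ~ S x) /\ exists r, forall x, S x -> vnorm n x <= r.

Definition is_C1 (n : nat) (V : vec -> R) (dV : vec -> vec) : Prop :=
  (forall x eps, 0 < eps -> exists d, 0 < d /\ forall h, vnorm n h < d ->
     Rabs (V (vadd x h) - V x - sum_lt n (fun i => dV x i * h i)) <= eps * vnorm n h)
  /\ (forall i, (i < n)%nat -> forall x eps, 0 < eps -> exists d, 0 < d /\
       forall y, vnorm n (vsub y x) < d -> Rabs (dV y i - dV x i) < eps).

Definition pos_semidef (V : vec -> R) : Prop := forall x, 0 <= V x.
Definition pos_def_R (phi : R -> R) : Prop := phi 0 = 0 /\ forall u, u <> 0 -> 0 < phi u.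

Definition strict_local_min (n : nat) (V : vec -> R) (xb : vec) : Prop :=
  exists d, 0 < d /\ forall x, 0 < vnorm n (vsub x xb) < d -> V xb < V x.

Definition LISP_storage (n : nat) (f : vec -> R -> vec) (g : vec -> R -> R)
    (ub : R) (xb : vec) (V : vec -> R) (dV : vec -> vec) : Prop :=
  exists (Om : R -> Prop) (X : vec -> Prop) (phi : R -> R),
    openR Om /\ Om ub /\ openV n X /\ X xb /\
    is_C1 n V dV /\ pos_semidef V /\ pos_def_R phi /\
    forall u x, Om u -> X x ->
      sum_lt n (fun i => dV x i * f x u i) <= (u - ub) * (g x u - g xb ub) - phi (u - ub).

Definition globally_lipschitz_f (n : nat) (f : vec -> R -> vec) : Prop :=
  exists L, forall x y u v, vnorm n (vsub (f x u) (f y v)) <= L * (vnorm n (vsub x y) + Rabs (u - v)).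
Definition globally_lipschitz_g (n : nat) (g : vec -> R -> R) : Prop :=
  exists L, forall x y u v, Rabs (g x u - g y v) <= L * (vnorm n (vsub x y) + Rabs (u - v)).

Definition ode_sol (n : nat) (F : vec -> vec) (phi : R -> vec) : Prop :=
  forall t i, (i < n)%nat -> derivable_pt_lim (fun s => phi s i) t (F (phi t) i).
Definition invariant_set (n : nat) (F : vec -> vec) (S : vec -> Prop) : Prop :=
  forall phi, ode_sol n F phi -> S (phi 0) -> forall t, S (phi t).

Definition edge := (nat * nat)%type.

Inductive uconn (E : list edge) : nat -> nat -> Prop :=
| uconn_refl i : uconn E i i
| uconn_fwd i j k : In (i, j) E -> uconn E j k -> uconn E i k
| uconn_bwd i j k : In (j, i) E -> uconn E j k -> uconn E i k.

(** N = {0,...,nN-1} (0-based relabelling of {1,...,|N|}) *)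
Definition valid_graph (nN : nat) (E : list edge) : Prop :=
  NoDup E /\
  (forall i j, In (i, j) E -> (i < nN)%nat /\ (j < nN)%nat) /\
  (forall i j, In (i, j) E -> ~ In (j, i) E) /\
  (forall i j, (i < nN)%nat -> (j < nN)%nat -> uconn E i j).

Record state := mkState { eta : edge -> R ; omega : nat -> R ; xs : nat -> vec }.

Definition ssub (x y : state) : state :=
  mkState (fun e => eta x e - eta y e) (fun j => omega x j - omega y j)
          (fun j => vsub (xs x j) (xs y j)).

Definition snorm (nN : nat) (E : list edge) (nd : nat -> nat) (x : state) : R :=
  sumR (map (fun e => Rabs (eta x e)) E)
  + sum_lt nN (fun j => Rabs (omega x j))
  + sum_lt nN (fun j => vnorm (nd j) (xs x j)).

Definition sdist nN E nd (x y : state) : R := snorm nN E nd (ssub x y).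

Definition openS nN E nd (O : state -> Prop) : Prop :=
  forall x, O x -> exists d, 0 < d /\ forall y, sdist nN E nd y x < d -> O y.

(** on-off load f^c_j and its Filippov set-valued map F[d^c_j] *)
Definition fc (dlo dhi wlo whi : R) (w : R) : R :=
  if Rlt_dec whi w then dhi else if Rlt_dec wlo w then 0 else dlo.

Definition Fdc (dlo dhi wlo whi : R) (w v : R) : Prop :=
  (w = whi /\ 0 <= v <= dhi) \/ (w = wlo /\ dlo <= v <= 0) \/
  (w <> whi /\ w <> wlo /\ v = fc dlo dhi wlo whi w).

Definition flow_out (E : list edge) (B : edge -> R) (x : state) (j : nat) : R :=
  sumR (map (fun e => B e * sin (eta x e)) (filter (fun e => Nat.eqb (fst e) j) E)).
Definition flow_in (E : list edge) (B : edge -> R) (x : state) (j : nat) : R :=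
  sumR (map (fun e => B e * sin (eta x e)) (filter (fun e => Nat.eqb (snd e) j) E)).

Definition Qmap (nN : nat) (E : list edge) (nd : nat -> nat)
    (M pL : nat -> R) (B : edge -> R)
    (f : nat -> vec -> R -> vec) (g : nat -> vec -> R -> R)
    (dlo dhi wlo whi : nat -> R) (x dx : state) : Prop :=
  (forall i j, In (i, j) E -> eta dx (i, j) = omega x i - omega x j) /\
  (forall j, (j < nN)%nat -> exists v, Fdc (dlo j) (dhi j) (wlo j) (whi j) (omega x j) v /\
     omega dx j = / M j * (- pL j + g j (xs x j) (- omega x j) - v
                           - flow_out E B x j + flow_in E B x j)) /\
  (forall j, (j < nN)%nat -> forall i, (i < nd j)%nat ->
     xs dx j i = f j (xs x j) (- omega x j) i).

Definition null_set (Z : R -> Prop) : Prop :=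
  forall eps, 0 < eps -> exists a b : nat -> R,
    (forall k, a k <= b k) /\ (forall t, Z t -> exists k, a k < t < b k) /\
    (forall m, sum_lt m (fun k => b k - a k) <= eps).

Fixpoint ordered_in (a b : R) (l : list (R * R)) : Prop :=
  match l with
  | [] => a <= b
  | (c, d) :: l' => a <= c /\ c <= d /\ ordered_in d b l'
  end.

Definition abs_cont_on (h : R -> R) (a b : R) : Prop :=
  forall eps, 0 < eps -> exists d, 0 < d /\ forall l, ordered_in a b l ->
    sumR (map (fun p => snd p - fst p) l) < d ->
    sumR (map (fun p => Rabs (h (snd p) - h (fst p))) l) < eps.

Definition abs_cont_traj nN E nd (x : R -> state) : Prop :=
  forall a b, 0 <= a -> a <= b ->
    (forall e, In e E -> abs_cont_on (fun t => eta (x t) e) a b) /\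
    (forall j, (j < nN)%nat -> abs_cont_on (fun t => omega (x t) j) a b) /\
    (forall j i, (j < nN)%nat -> (i < nd j)%nat -> abs_cont_on (fun t => xs (x t) j i) a b).

Definition has_deriv nN E nd (x : R -> state) (t : R) (dx : state) : Prop :=
  (forall e, In e E -> derivable_pt_lim (fun s => eta (x s) e) t (eta dx e)) /\
  (forall j, (j < nN)%nat -> derivable_pt_lim (fun s => omega (x s) j) t (omega dx j)) /\
  (forall j i, (j < nN)%nat -> (i < nd j)%nat ->
     derivable_pt_lim (fun s => xs (x s) j i) t (xs dx j i)).

Definition filippov_sol nN E nd M pL B f g dlo dhi wlo whi (x : R -> state) : Prop :=
  abs_cont_traj nN E nd x /\
  exists Z, null_set Z /\ forall t, 0 <= t -> ~ Z t ->
    exists dx, has_deriv nN E nd x t dx /\ Qmap nN E nd M pL B f g dlo dhi wlo whi (x t) dx.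

Definition zero_state : state := mkState (fun _ => 0) (fun _ => 0) (fun _ _ => 0).

Definition is_equilibrium nN E nd M pL B f g dlo dhi wlo whi (x : state) : Prop :=
  Qmap nN E nd M pL B f g dlo dhi wlo whi x zero_state.

(* Main.v *)
(* The energy W = [energy V] (kinetic energy, edge potentials relative to eta*, and the storage
   functions) has a strict local minimum at x*.  Along a Filippov solution the edge terms cancel by
   summation by parts and the on-off loads only dissipate, so W' is at most a continuous function of
   the state that is negative as soon as some omega_j is nonzero.  Hence a small sublevel set of W
   traps solutions; there solutions are Lipschitz in time and W' is bounded away from 0 where
   |omega_j| >= eps (by compactness; the functions phi_j need no regularity), which forces
   omega -> 0.

   No invariance principle for differential inclusions is needed after that.  A limit point has
   omega = 0 and balanced power, since otherwise some omega_j would keep growing by a fixed amount;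
   and the limit set of x_j^s is compact and, by a Gronwall estimate, invariant under
   x' = f_j(x, 0), so it consists of equilibria by (A1)(ii).

   Almost everywhere derivatives enter only through [ac_growth], proved by real induction instead of
   measure theory. *)
Require Import Defs.
From Stdlib Require Import Reals Lra Lia List Classical IndefiniteDescription ClassicalEpsilon FunctionalExtensionality.
Import ListNotations.
Open Scope R_scope.

(** Late in time every omega_j lies strictly between its thresholds, where the only load value is 0;
    there the inclusion for omega_j is an equation with a continuous right-hand side, although the
    loads themselves are discontinuous.

    A positive definite phi_j may come arbitrarily close to 0 away from the origin, so by itself it
    gives no uniform decay rate. Compactness is therefore applied to [dissipation], which is
    continuous and which phi_j makes negative pointwise.

    Assumption (A1)(ii) speaks of each bus separately, and a bus sees the network only through
    omega_j. Its limit set can thus be studied alone, with the limiting input 0. Invariance there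
    concerns solutions given on the whole real line, so such a solution is compared with the
    trajectory both forward and backward in time. *)

Local Notation sumL F L := (sumR (map F L)).

(** * Finite sums, uniform choices over finite lists, real induction *)

Lemma sumL_ext {A} (F G : A -> R) L :
  (forall a, In a L -> F a = G a) -> sumL F L = sumL G L.
Proof. intros H. f_equal. now apply map_ext_in. Qed.

Lemma sumL_plus {A} (F G : A -> R) L :
  sumL (fun a => F a + G a) L = sumL F L + sumL G L.
Proof. induction L as [|a L IH]; simpl in *; [lra|]. rewrite IH; lra. Qed.

Lemma sumL_minus {A} (F G : A -> R) L :
  sumL (fun a => F a - G a) L = sumL F L - sumL G L.
Proof. induction L as [|a L IH]; simpl in *; [lra|]. rewrite IH; lra. Qed.

Lemma sumL_scal {A} (c : R) (F : A -> R) L :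
  sumL (fun a => c * F a) L = c * sumL F L.
Proof. induction L as [|a L IH]; simpl in *; [lra|]. rewrite IH; lra. Qed.

Lemma sumL_zero {A} (F : A -> R) L : (forall a, In a L -> F a = 0) -> sumL F L = 0.
Proof.
  induction L as [|a L IH]; simpl; intros H; [reflexivity|].
  rewrite IH, (H a); auto. ring.
Qed.

Lemma sumL_le {A} (F G : A -> R) L :
  (forall a, In a L -> F a <= G a) -> sumL F L <= sumL G L.
Proof.
  induction L as [|a L IH]; simpl; intros H; [lra|].
  specialize (IH (fun b Hb => H b (or_intror Hb))). specialize (H a (or_introl eq_refl)). lra.
Qed.

Lemma sumL_nonneg {A} (F : A -> R) L :
  (forall a, In a L -> 0 <= F a) -> 0 <= sumL F L.
Proof.
  induction L as [|a L IH]; simpl; intros H; [lra|].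
  specialize (IH (fun b Hb => H b (or_intror Hb))). specialize (H a (or_introl eq_refl)). lra.
Qed.

Lemma sumL_elem_le {A} (F : A -> R) L a :
  (forall a, In a L -> 0 <= F a) -> In a L -> F a <= sumL F L.
Proof.
  induction L as [|b L IH]; simpl; intros H [].
  - subst. pose proof (sumL_nonneg F L (fun b Hb => H b (or_intror Hb))). lra.
  - specialize (IH (fun b Hb => H b (or_intror Hb)) H0). specialize (H b (or_introl eq_refl)). lra.
Qed.

Lemma sumL_le_elem {A} (F : A -> R) L a :
  (forall a, In a L -> F a <= 0) -> In a L -> sumL F L <= F a.
Proof.
  intros H Ha. pose proof (sumL_elem_le (fun a => -1 * F a) L a) as HH.
  rewrite sumL_scal in HH. enough (-1 * F a <= -1 * sumL F L) by lra. apply HH; auto.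
  intros b Hb; specialize (H b Hb); lra.
Qed.

Lemma sumL_abs {A} (F : A -> R) L : Rabs (sumL F L) <= sumL (fun a => Rabs (F a)) L.
Proof.
  induction L as [|a L IH]; simpl; [rewrite Rabs_R0; lra|].
  pose proof (Rabs_triang (F a) (sumL F L)). lra.
Qed.

Lemma sumL_app {A} (F : A -> R) L L' : sumL F (L ++ L') = sumL F L + sumL F L'.
Proof. induction L as [|a L IH]; simpl; [lra|]. rewrite IH; lra. Qed.

Lemma sumL_bound {A} (F : A -> R) L c :
  (forall a, In a L -> F a <= c) -> sumL F L <= INR (length L) * c.
Proof.
  induction L as [|a L IH]; intros H; [simpl; lra|].
  specialize (IH (fun b Hb => H b (or_intror Hb))). specialize (H a (or_introl eq_refl)).
  change (length (a :: L)) with (S (length L)). rewrite S_INR. simpl. lra.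
Qed.

Lemma in_seq0 n i : In i (seq 0 n) <-> (i < n)%nat.
Proof. rewrite in_seq. lia. Qed.

(** Stands for the minimum of finitely many local radii; [P a] must survive shrinking.
    [finite_bound] is the dual, with a maximum. *)
Lemma finite_radius {A} (L : list A) (P : A -> R -> Prop) :
  (forall a r r', P a r -> 0 < r' <= r -> P a r') ->
  (forall a, In a L -> exists r, 0 < r /\ P a r) ->
  exists r, 0 < r /\ forall a, In a L -> P a r.
Proof.
  intros Hm. induction L as [|a L IH]; intros H.
  - exists 1. split; [lra | intros ? []].
  - destruct IH as (r & Hr & Hr'). { intros; apply H; simpl; auto. }
    destruct (H a) as (s & Hs & Hs'); [simpl; auto|].
    exists (Rmin r s). pose proof (Rmin_l r s); pose proof (Rmin_r r s).
    assert (0 < Rmin r s) by (apply Rmin_pos; auto).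
    split; auto. intros b [->|Hb]; eapply Hm; eauto.
Qed.

Lemma finite_bound {A} (L : list A) (P : A -> R -> Prop) :
  (forall a r r', P a r -> r <= r' -> P a r') ->
  (forall a, In a L -> exists r, P a r) ->
  exists r, 0 < r /\ forall a, In a L -> P a r.
Proof.
  intros Hm. induction L as [|a L IH]; intros H.
  - exists 1. split; [lra | intros ? []].
  - destruct IH as (r & Hr & Hr'). { intros; apply H; simpl; auto. }
    destruct (H a) as (s & Hs'); [simpl; auto|].
    exists (Rmax r s). pose proof (Rmax_l r s); pose proof (Rmax_r r s).
    split; [lra|]. intros b [->|Hb]; eapply Hm; eauto.
Qed.

(** Let [m] be the supremum of the [s] such that [P] holds on [a, s]. The left-limit hypothesis
    gives [P m], and the right-step hypothesis would pass beyond [m] if [m < b]. *)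
Lemma real_induction (a b : R) (P : R -> Prop) :
  P a ->
  (forall t, a <= t < b -> P t -> exists r, 0 < r /\ forall s, t < s < t + r -> s <= b -> P s) ->
  (forall t, a < t <= b -> (forall s, a <= s < t -> P s) -> P t) ->
  forall t, a <= t <= b -> P t.
Proof.
  intros H0 Hr Hl t Ht.
  set (S := fun s => a <= s <= b /\ forall u, a <= u <= s -> P u).
  assert (HSa : S a).
  { split; [lra|]. intros u Hu. replace u with a by lra. auto. }
  destruct (completeness S) as (m & Hub & Hlub).
  { exists b. intros s [Hs _]; lra. } { exists a; auto. }
  assert (Hma : a <= m) by (apply Hub; auto).
  assert (Hmb : m <= b) by (apply Hlub; intros s [Hs _]; lra).
  assert (Hbelow : forall s, a <= s < m -> P s).
  { intros s Hs. destruct (classic (exists u, S u /\ s < u)) as [(u & Hu & Hsu)|Hn].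
    - apply (proj2 Hu). lra.
    - exfalso. assert (m <= s); [|lra]. apply Hlub. intros u Hu.
      destruct (Rle_dec u s); auto. exfalso; apply Hn; exists u; split; auto; lra. }
  assert (HPm : P m).
  { destruct (Req_dec m a) as [->|]; auto. apply Hl; auto. lra. }
  destruct (Rlt_dec m b) as [Hlt|].
  - exfalso. destruct (Hr m) as (r & Hrp & Hrr); [lra|auto|].
    set (s := Rmin b (m + r/2)).
    assert (s <= b /\ s <= m + r/2 /\ m < s).
    { unfold s. split; [apply Rmin_l|split;[apply Rmin_r|]]. apply Rmin_glb_lt; lra. }
    assert (S s).
    { split; [lra|]. intros u Hu. destruct (Rle_lt_dec u m) as [Hle|].
      - destruct (Req_dec u m) as [->|]; auto. apply Hbelow; lra.
      - apply Hrr; lra. }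
    assert (s <= m) by (apply Hub; auto). lra.
  - destruct (Req_dec t m) as [->|]; auto. apply Hbelow; lra.
Qed.

(** * Absolutely continuous functions *)

Lemma ordered_in_le a b l : ordered_in a b l -> a <= b.
Proof.
  revert a; induction l as [|[c d] l IH]; simpl; intros a H; auto.
  destruct H as (? & ? & H). apply IH in H. lra.
Qed.

Lemma ordered_in_app a t s l : ordered_in a t l -> t <= s -> ordered_in a s (l ++ [(t, s)]).
Proof.
  revert a; induction l as [|[c d] l IH]; simpl; intros a H Hs.
  - repeat split; lra.
  - destruct H as (? & ? & H). auto.
Qed.

Lemma ordered_in_widen a t s l : ordered_in a t l -> t <= s -> ordered_in a s l.
Proof.
  revert a; induction l as [|[c d] l IH]; simpl; intros a H Hs; [lra|].
  destruct H as (? & ? & H). auto.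
Qed.

Lemma ordered_in_In a b l p : ordered_in a b l -> In p l -> a <= fst p /\ fst p <= snd p /\ snd p <= b.
Proof.
  revert a; induction l as [|[c d] l IH]; simpl; intros a H [].
  - subst; simpl. destruct H as (? & ? & H). apply ordered_in_le in H. lra.
  - destruct H as (? & ? & H). destruct (IH d) as (? & ? & ?); auto. lra.
Qed.

(* Distribution function of the intervals [a k, b k], k < m: it turns the total length of
   disjoint intervals, each inside one of the [a k, b k], into a telescoping sum. *)
Definition clampF (a b : nat -> R) (m : nat) (x : R) : R :=
  sum_lt m (fun k => Rmax (a k) (Rmin x (b k))).

Lemma clamp_mono a b x y : x <= y -> 0 <= Rmax a (Rmin y b) - Rmax a (Rmin x b).
Proof. intros. unfold Rmax, Rmin. repeat destruct (Rle_dec _ _); lra. Qed.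

Lemma clampF_diff a b m x y :
  clampF a b m y - clampF a b m x =
  sum_lt m (fun k => Rmax (a k) (Rmin y (b k)) - Rmax (a k) (Rmin x (b k))).
Proof. unfold clampF, sum_lt. now rewrite sumL_minus. Qed.

Lemma clampF_mono a b m x y : x <= y -> 0 <= clampF a b m y - clampF a b m x.
Proof. intros. rewrite clampF_diff. apply sumL_nonneg. intros; now apply clamp_mono. Qed.

(** Additional intervals only add nondecreasing summands. The induction in [ac_growth] uses more and
    more intervals of the cover, so earlier length bounds must survive a larger index. *)
Lemma clampF_widen a b m p x y : x <= y ->
  clampF a b m y - clampF a b m x <= clampF a b (m + p) y - clampF a b (m + p) x.
Proof.
  intros. rewrite !clampF_diff. unfold sum_lt. rewrite seq_app, sumL_app.
  match goal with |- ?u <= ?u + ?v => enough (0 <= v) by lra end.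
  apply sumL_nonneg. intros; now apply clamp_mono.
Qed.

(** The [k]-th summand is the identity on [a k, b k], and the others are nondecreasing. *)
Lemma clampF_step a b m k x y : (k < m)%nat -> a k <= x <= y -> y <= b k ->
  y - x <= clampF a b m y - clampF a b m x.
Proof.
  intros Hk Hx Hy. rewrite clampF_diff.
  eapply Rle_trans; [|apply (sumL_elem_le _ (seq 0 m) k)].
  - unfold Rmax, Rmin. repeat destruct (Rle_dec _ _); lra.
  - intros; now apply clamp_mono.
  - now apply in_seq0.
Qed.

Lemma clampF_total a b m x y : (forall k, a k <= b k) ->
  clampF a b m y - clampF a b m x <= sum_lt m (fun k => b k - a k).
Proof.
  intros H. rewrite clampF_diff. apply sumL_le. intros k _. specialize (H k).
  unfold Rmax, Rmin. repeat destruct (Rle_dec _ _); lra.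
Qed.

(* Real induction on [t]: the increment over [a, t] is at most (c + e)(t - a) plus the variation
   of [h] over finitely many disjoint intervals contained in the small cover of [Z]. *)
Lemma ac_growth h a b c Z (D : R -> R) :
  null_set Z -> a <= b -> abs_cont_on h a b ->
  (forall t, a <= t <= b -> ~ Z t -> derivable_pt_lim h t (D t) /\ D t <= c) ->
  h b - h a <= c * (b - a).
Proof.
  intros HZ Hab Hac HD.
  (* Both sides of [t] are needed: the right one to step forward in real induction, the left one to
     reach [t] from earlier points. *)
  assert (Hloc : forall e, 0 < e -> forall t, a <= t <= b -> ~ Z t -> exists r, 0 < r /\
    forall s, Rabs (s - t) < r ->
      (t < s -> h s - h t <= (c + e) * (s - t)) /\ (s < t -> h t - h s <= (c + e) * (t - s))).
  { intros e He t Ht HZt. destruct (HD t Ht HZt) as [Hd Hc].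
    destruct (Hd e He) as [r Hr]. exists r. split; [apply cond_pos|].
    intros s Hs.
    assert (Hq : s <> t -> (h s - h t) / (s - t) < c + e).
    { intros Hst. specialize (Hr (s - t)). replace (t + (s - t)) with s in Hr by ring.
      apply Rabs_def2 in Hr; lra. }
    split; intros Hlt.
    - replace (h s - h t) with ((h s - h t) / (s - t) * (s - t)) by (field; lra).
      apply Rmult_le_compat_r; [lra|]. left; apply Hq; lra.
    - replace (h t - h s) with ((h s - h t) / (s - t) * (t - s)) by (field; lra).
      apply Rmult_le_compat_r; [lra|]. left; apply Hq; lra. }
  assert (Hmain : forall e, 0 < e -> h b - h a <= (c + e) * (b - a) + 2 * e).
  { intros e He. destruct (Hac e He) as (d & Hd & Hvar).
    (* On an interval of the cover only the variation of [h] is controlled. Writing it in the form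
       required by [P] leaves an error - (c + e) times the length, which is positive when c + e is
       negative; [C] pays for it. *)
    set (C := Rabs (c + e)). assert (HC : 0 <= C) by apply Rabs_pos.
    assert (HcC : - (c + e) <= C) by (unfold C; rewrite <- Rabs_Ropp; apply Rle_abs).
    assert (HeC : 0 < e / (C + 1)) by (apply Rdiv_lt_0_compat; lra).
    (* A total length below [d] makes the variation of [h] smaller than [e]; a length at most e / (C
       + 1) makes the error [C] times the length at most [e]. Together they are the [2 * e] of
       [Hmain]. *)
    destruct (HZ (Rmin (d/2) (e / (C + 1)))) as (ak & bk & Hk & Hcov & Htot).
    { apply Rmin_pos; lra. }
    set (P := fun t => exists l m, ordered_in a t l /\
      sumL (fun p => snd p - fst p) l <= clampF ak bk m t - clampF ak bk m a /\
      h t - h a <= (c + e) * (t - a) + sumL (fun p => Rabs (h (snd p) - h (fst p))) l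
                   + C * sumL (fun p => snd p - fst p) l).
    assert (Hstep1 : forall s t, a <= s <= t -> P s -> h t - h s <= (c + e) * (t - s) -> P t).
    { intros s t Hst (l & m & Hl & Hlen & Hh) Hinc. exists l, m. repeat split.
      - eapply ordered_in_widen; eauto; lra.
      - pose proof (clampF_mono ak bk m s t). lra.
      - lra. }
    assert (Hstep2 : forall s t k, a <= s <= t -> P s -> ak k <= s -> t <= bk k -> P t).
    { intros s t k Hst (l & m & Hl & Hlen & Hh) Hs Ht.
      (* Going up to [m + S k] puts the index [k] among those counted by [clampF]. *)
      exists (l ++ [(s, t)]), (m + S k)%nat. repeat split.
      - apply ordered_in_app; auto; lra.
      - rewrite sumL_app. simpl.
        pose proof (clampF_step ak bk (m + S k) k s t).
        pose proof (clampF_widen ak bk m (S k) a s).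
        assert (k < m + S k)%nat by lia. specialize (H H1). lra.
      - rewrite !sumL_app. simpl.
        pose proof (Rle_abs (h t - h s)).
        assert (0 <= (C + (c + e)) * (t - s)) by (apply Rmult_le_pos; lra). lra. }
    assert (HP : P b).
    { apply (real_induction a b P); [| | |lra].
      - exists [], 0%nat. simpl. unfold clampF, sum_lt; simpl. repeat split; lra.
      - intros t Ht HPt. destruct (classic (Z t)) as [Hz|Hz].
        + destruct (Hcov t Hz) as (k & Hkt). exists (bk k - t). split; [lra|].
          intros s Hs _. apply (Hstep2 t s k); auto; lra.
        + destruct (Hloc e He t) as (r & Hr & Hr'); [lra|auto|].
          exists r. split; auto. intros s Hs _. apply (Hstep1 t s); auto; [lra|].
          apply Hr'; [rewrite Rabs_pos_eq; lra | lra].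
      - intros t Ht HPs. destruct (classic (Z t)) as [Hz|Hz].
        + destruct (Hcov t Hz) as (k & Hkt). set (s := Rmax a ((ak k + t)/2)).
          assert (a <= s /\ ak k <= s < t).
          { unfold s, Rmax; destruct (Rle_dec _ _); lra. }
          apply (Hstep2 s t k); try lra. apply HPs; lra.
        + destruct (Hloc e He t) as (r & Hr & Hr'); [lra|auto|].
          set (s := Rmax a (t - r/2)).
          assert (a <= s /\ t - r/2 <= s < t).
          { unfold s, Rmax; destruct (Rle_dec _ _); lra. }
          apply (Hstep1 s t); [lra| |]. { apply HPs; lra. }
          apply Hr'; [rewrite Rabs_minus_sym, Rabs_pos_eq; lra | lra]. }
    destruct HP as (l & m & Hl & Hlen & Hh).
    assert (Hsmall : sumL (fun p => snd p - fst p) l <= Rmin (d/2) (e / (C + 1))).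
    { pose proof (clampF_total ak bk m a b Hk). specialize (Htot m). lra. }
    pose proof (Rmin_l (d/2) (e / (C + 1))). pose proof (Rmin_r (d/2) (e / (C + 1))).
    specialize (Hvar l Hl).
    assert (C * sumL (fun p => snd p - fst p) l <= e).
    { apply Rle_trans with (C * (e / (C + 1))); [apply Rmult_le_compat_l; lra|].
      apply Rle_trans with ((C + 1) * (e / (C + 1))); [nra|].
      right; field; lra. }
    lra. }
  apply Rnot_lt_le; intros Hlt.
  set (q := h b - h a - c * (b - a)) in *.
  assert (0 < q) by (unfold q; lra).
  (* With this [e] the total error e (b - a) + 2 e is q / 2, too small for the excess [q]. *)
  specialize (Hmain (q / (2 * (b - a + 2)))).
  assert (He : 0 < q / (2 * (b - a + 2))) by (apply Rdiv_lt_0_compat; lra).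
  specialize (Hmain He).
  assert (q / (2 * (b - a + 2)) * (b - a + 2) = q / 2) by (field; lra).
  unfold q in *. lra.
Qed.

(* [D] is the derivative of [h] outside the null set [Z]; local absolute continuity is asked on
   bounded subintervals of the half-line only. *)
Definition ACD (Z : R -> Prop) (h D : R -> R) : Prop :=
  (forall t, 0 <= t -> exists r, 0 < r /\
     forall a b, 0 <= a -> t - r < a -> a <= b -> b < t + r -> abs_cont_on h a b) /\
  (forall t, 0 <= t -> ~ Z t -> derivable_pt_lim h t (D t)).

(** Each short window is handled by [ac_growth], and real induction glues the windows. This is the
    substitute for integrating the derivative. *)
Lemma ACD_growth Z h D a b c :
  null_set Z -> ACD Z h D -> 0 <= a -> a <= b ->
  (forall t, a <= t <= b -> ~ Z t -> D t <= c) -> h b - h a <= c * (b - a).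
Proof.
  intros HZ [Hac Hder] Ha Hab HD.
  apply (real_induction a b (fun t => h t - h a <= c * (t - a))); [lra| | |lra].
  - intros t Ht HP. destruct (Hac t) as (r & Hr & Hr'); [lra|].
    exists r; split; auto. intros s Hs Hsb.
    assert (h s - h t <= c * (s - t)); [|lra].
    apply (ac_growth h t s c Z D); auto; [lra|apply Hr'; lra|].
    intros u Hu Hz. split; [apply Hder|apply HD]; auto; lra.
  - intros t Ht HP. destruct (Hac t) as (r & Hr & Hr'); [lra|].
    set (s := Rmax a (t - r/2)).
    assert (a <= s /\ t - r/2 <= s < t).
    { unfold s, Rmax; destruct (Rle_dec _ _); lra. }
    specialize (HP s ltac:(lra)).
    assert (h t - h s <= c * (t - s)); [|lra].
    apply (ac_growth h s t c Z D); auto; [lra|apply Hr'; lra|].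
    intros u Hu Hz. split; [apply Hder|apply HD]; auto; lra.
Qed.

Lemma ACD_cont Z h D t : ACD Z h D -> 0 <= t -> forall eps, 0 < eps ->
  exists d, 0 < d /\ forall s, 0 <= s -> Rabs (s - t) < d -> Rabs (h s - h t) < eps.
Proof.
  intros [Hac _] Ht eps He. destruct (Hac t Ht) as (r & Hr & Hr').
  set (a := Rmax 0 (t - r/2)). set (b := t + r/2).
  assert (Hab : 0 <= a /\ t - r/2 <= a <= t /\ (a = 0 \/ a = t - r/2)).
  { unfold a, Rmax; destruct (Rle_dec _ _); lra. }
  destruct (Hr' a b) with (eps := eps) as (d & Hd & Hd'); try (unfold b; lra).
  exists (Rmin d (r/2)). split; [apply Rmin_pos; lra|].
  pose proof (Rmin_l d (r/2)); pose proof (Rmin_r d (r/2)).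
  intros s Hs Hst. apply Rabs_def2 in Hst.
  destruct (Rle_lt_dec s t).
  - specialize (Hd' [(s, t)]). simpl in Hd'. rewrite Rabs_minus_sym.
    rewrite Rplus_0_r in Hd'. rewrite Rplus_0_r in Hd'. apply Hd'; unfold b; lra.
  - specialize (Hd' [(t, s)]). simpl in Hd'.
    rewrite Rplus_0_r in Hd'. rewrite Rplus_0_r in Hd'. apply Hd'; unfold b; lra.
Qed.

(** Gives absolute continuity of sums and of C1 functions of coordinates. The increment bound is
    asked on [a, b] only, so a locally Lipschitz function qualifies on a short window. *)
Lemma abs_cont_on_lipschitz {A} (L : list A) (x : A -> R -> R) (F : R -> R) K a b :
  (forall i, In i L -> abs_cont_on (x i) a b) ->
  (forall c d, a <= c -> c <= d -> d <= b ->
     Rabs (F d - F c) <= K * sumL (fun i => Rabs (x i d - x i c)) L) ->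
  abs_cont_on F a b.
Proof.
  intros Hx HF.
  assert (Hsum : forall eps, 0 < eps -> exists d, 0 < d /\ forall l, ordered_in a b l ->
    sumL (fun p => snd p - fst p) l < d ->
    sumL (fun p => sumL (fun i => Rabs (x i (snd p) - x i (fst p))) L) l < eps).
  { clear HF. induction L as [|i L IH]; intros eps He.
    - exists 1; split; [lra|]. intros l _ _. simpl. clear -He. induction l; simpl; lra.
    - destruct IH with (eps := eps/2) as (d1 & Hd1 & H1); [intros; apply Hx; simpl; auto|lra|].
      destruct (Hx i (or_introl eq_refl) (eps/2)) as (d2 & Hd2 & H2); [lra|].
      exists (Rmin d1 d2). split; [apply Rmin_pos; auto|]. intros l Hl Hlen.
      pose proof (Rmin_l d1 d2); pose proof (Rmin_r d1 d2).
      specialize (H1 l Hl ltac:(lra)). specialize (H2 l Hl ltac:(lra)).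
      simpl. rewrite sumL_plus. lra. }
  (* [K] may be zero or negative; [K'] is a positive constant above it, by which one can divide. *)
  intros eps He. set (K' := Rmax K 0 + 1).
  assert (HK : K <= K' /\ 1 <= K') by (unfold K', Rmax; destruct (Rle_dec _ _); lra).
  destruct (Hsum (eps / K')) as (d & Hd & H); [apply Rdiv_lt_0_compat; lra|].
  exists d; split; auto. intros l Hl Hlen. specialize (H l Hl Hlen).
  apply Rle_lt_trans with
    (K' * sumL (fun p => sumL (fun i => Rabs (x i (snd p) - x i (fst p))) L) l).
  - rewrite <- sumL_scal. apply sumL_le. intros p Hp.
    destruct (ordered_in_In _ _ _ _ Hl Hp) as (? & ? & ?).
    eapply Rle_trans; [apply HF; auto|]. apply Rmult_le_compat_r; [|lra].
    apply sumL_nonneg; intros; apply Rabs_pos.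
  - apply Rlt_le_trans with (K' * (eps / K')); [apply Rmult_lt_compat_l; lra|].
    right; field; lra.
Qed.

Lemma ACD_family Z {A} (L : list A) (x D : A -> R -> R) t :
  (forall i, In i L -> ACD Z (x i) (D i)) -> 0 <= t ->
  exists r, 0 < r /\ forall i, In i L ->
    forall a b, 0 <= a -> t - r < a -> a <= b -> b < t + r -> abs_cont_on (x i) a b.
Proof.
  intros H Ht. apply (finite_radius L (fun i r => forall a b, 0 <= a -> t - r < a -> a <= b ->
    b < t + r -> abs_cont_on (x i) a b)).
  - intros i r r' Hr Hr' a b; intros; apply Hr; lra.
  - intros i Hi. apply (proj1 (H i Hi)); auto.
Qed.

(** * Norms and C1 functions of several variables *)

Lemma vnorm_nonneg n v : 0 <= vnorm n v.
Proof. apply sumL_nonneg; intros; apply Rabs_pos. Qed.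

Lemma vnorm_elem n v i : (i < n)%nat -> Rabs (v i) <= vnorm n v.
Proof.
  intros. apply (sumL_elem_le (fun i => Rabs (v i))); [intros; apply Rabs_pos|now apply in_seq0].
Qed.

Lemma vnorm_triang n u v w : vnorm n (vsub u w) <= vnorm n (vsub u v) + vnorm n (vsub v w).
Proof.
  unfold vnorm, sum_lt, vsub. rewrite <- sumL_plus. apply sumL_le. intros i _.
  replace (u i - w i) with ((u i - v i) + (v i - w i)) by ring. apply Rabs_triang.
Qed.

Lemma vnorm_ext n v w : (forall i, (i < n)%nat -> v i = w i) -> vnorm n v = vnorm n w.
Proof. intros H. apply sumL_ext. intros i Hi. rewrite H; auto. now apply in_seq0. Qed.

Lemma vnorm_sym n v w : vnorm n (vsub v w) = vnorm n (vsub w v).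
Proof. apply sumL_ext. intros i _. apply Rabs_minus_sym. Qed.

Lemma vnorm_refl n v : vnorm n (vsub v v) = 0.
Proof.
  unfold vnorm, sum_lt. induction (seq 0 n); simpl; auto.
  rewrite IHl. unfold vsub. rewrite Rminus_diag, Rabs_R0. lra.
Qed.

Lemma vadd_vsub v w : vadd v (vsub w v) = w.
Proof. extensionality i. unfold vadd, vsub. ring. Qed.

(** A [vec] is a whole sequence, so [V] could a priori read components beyond [n]. A displacement of
    norm 0 has zero linear part and remainder bound 0, so [V] cannot change along it. *)
Lemma C1_ext n V dV v w : is_C1 n V dV -> (forall i, (i < n)%nat -> v i = w i) -> V v = V w.
Proof.
  intros [HV _] H. destruct (HV v 1 Rlt_0_1) as (d & Hd & Hd').
  assert (Hz : vnorm n (vsub w v) = 0).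
  { rewrite <- (vnorm_refl n v). apply vnorm_ext. intros i Hi. unfold vsub. rewrite H; auto. }
  specialize (Hd' (vsub w v)). rewrite vadd_vsub, Hz in Hd'.
  replace (sum_lt n _) with 0 in Hd'.
  - specialize (Hd' Hd). rewrite Rmult_0_r, Rminus_0_r in Hd'.
    pose proof (Rabs_pos (V w - V v)). assert (Rabs (V w - V v) = 0) as Ha by lra.
    destruct (Req_dec (V w - V v) 0); [lra|]. apply Rabs_no_R0 in H1. lra.
  - symmetry. apply sumL_zero. intros i Hi. apply in_seq0 in Hi. unfold vsub. rewrite H; auto. ring.
Qed.

Lemma C1_cont n V dV x : is_C1 n V dV -> forall eps, 0 < eps ->
  exists d, 0 < d /\ forall y, vnorm n (vsub y x) < d -> Rabs (V y - V x) < eps.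
Proof.
  intros [HV _] eps He. destruct (HV x 1 Rlt_0_1) as (d & Hd & H).
  set (K := sum_lt n (fun i => Rabs (dV x i)) + 1).
  assert (HK0 : 0 <= sum_lt n (fun i => Rabs (dV x i))) by (apply sumL_nonneg; intros; apply Rabs_pos).
  exists (Rmin d (eps / (K + 1))). split.
  { apply Rmin_pos; auto. apply Rdiv_lt_0_compat; unfold K; lra. }
  intros y Hy. pose proof (Rmin_l d (eps/(K+1))); pose proof (Rmin_r d (eps/(K+1))).
  specialize (H (vsub y x) ltac:(lra)). rewrite vadd_vsub in H.
  set (N := vnorm n (vsub y x)) in *.
  assert (HN : 0 <= N) by apply vnorm_nonneg.
  assert (Hs : Rabs (sum_lt n (fun i => dV x i * vsub y x i)) <= (K - 1) * N).
  { eapply Rle_trans; [apply sumL_abs|].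
    apply Rle_trans with (sumL (fun i => N * Rabs (dV x i)) (seq 0 n)).
    - apply sumL_le. intros i Hi. rewrite Rabs_mult, Rmult_comm.
      apply Rmult_le_compat_r; [apply Rabs_pos|]. apply vnorm_elem. now apply in_seq0.
    - rewrite sumL_scal. unfold K, sum_lt. lra. }
  assert (HKp : 0 < K + 1) by (unfold K; lra).
  assert ((K + 1) * N < eps).
  { apply Rlt_le_trans with ((K+1) * (eps / (K+1))).
    - apply Rmult_lt_compat_l; lra.
    - right. field. lra. }
  revert H Hs. generalize (sum_lt n (fun i => dV x i * vsub y x i)). intros q H Hs.
  assert (Rabs (V y - V x) <= Rabs (V y - V x - q) + Rabs q).
  { replace (V y - V x) with ((V y - V x - q) + q) at 1 by ring. apply Rabs_triang. }
  unfold K in *. lra.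
Qed.

(** In some ball around [x0] the partial derivatives stay within 1 of their values at [x0]. The ball
    is convex, so the mean value theorem applies along the segment from [y] to [z]. *)
Lemma C1_locally_lipschitz n V dV x0 : is_C1 n V dV ->
  exists d K, 0 < d /\ forall y z, vnorm n (vsub y x0) < d -> vnorm n (vsub z x0) < d ->
    Rabs (V z - V y) <= K * vnorm n (vsub z y).
Proof.
  intros HC1. pose proof HC1 as [HV HdV].
  destruct (finite_radius (seq 0 n) (fun i d => forall y, vnorm n (vsub y x0) < d ->
              Rabs (dV y i - dV x0 i) < 1)) as (d & Hd & Hball).
  { intros i r r' H Hr y Hy. apply H. lra. }
  { intros i Hi. apply HdV; [now apply in_seq0|lra]. }
  destruct (finite_bound (seq 0 n) (fun i K => Rabs (dV x0 i) <= K)) as (K & HK & HdK).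
  { intros; lra. } { intros i _. eexists; apply Rle_refl. }
  exists d, (K + 1). split; auto. intros y z Hy Hz.
  set (w := vsub z y). set (p := fun s : R => vadd y (fun i => s * w i)).
  set (phi := fun s => V (p s)).
  set (dphi := fun s => sum_lt n (fun i => dV (p s) i * w i)).
  assert (Hder : forall c, 0 <= c <= 1 -> derivable_pt_lim phi c (dphi c)).
  { intros c _ eps He. set (N := vnorm n w).
    assert (HN : 0 <= N) by apply vnorm_nonneg.
    destruct (HV (p c) (eps / (N + 1))) as (r & Hr & H); [apply Rdiv_lt_0_compat; lra|].
    assert (Hr' : 0 < r / (N + 1)) by (apply Rdiv_lt_0_compat; lra).
    exists (mkposreal _ Hr'). simpl. intros h Hh0 Hh.
    specialize (H (fun i => h * w i)).
    assert (Hn : vnorm n (fun i => h * w i) = Rabs h * N).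
    { unfold N, vnorm, sum_lt. rewrite <- sumL_scal. apply sumL_ext. intros; apply Rabs_mult. }
    assert (Hp : vadd (p c) (fun i => h * w i) = p (c + h)).
    { extensionality i. unfold p, vadd. ring. }
    assert (Hs : sum_lt n (fun i => dV (p c) i * (h * w i)) = h * dphi c).
    { unfold dphi, sum_lt. rewrite <- sumL_scal. apply sumL_ext. intros; ring. }
    rewrite Hn, Hp, Hs in H.
    assert (Hha : 0 < Rabs h) by now apply Rabs_pos_lt.
    assert (Rabs h * (N + 1) < r).
    { apply Rlt_le_trans with (r / (N+1) * (N + 1)); [apply Rmult_lt_compat_r; lra|].
      right; field; lra. }
    specialize (H ltac:(nra)). fold (phi (c + h)) in H. fold (phi c) in H.
    replace ((phi (c + h) - phi c) / h - dphi c) with ((phi (c+h) - phi c - h * dphi c) / h)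
      by (field; auto).
    unfold Rdiv at 1. rewrite Rabs_mult, Rabs_inv.
    apply Rmult_lt_reg_r with (Rabs h); auto. rewrite Rmult_assoc, Rinv_l by lra.
    rewrite Rmult_1_r. eapply Rle_lt_trans; [exact H|].
    apply Rlt_le_trans with (eps / (N+1) * (Rabs h * (N + 1))); [|right; field; lra].
    apply Rmult_lt_compat_l; [apply Rdiv_lt_0_compat; lra|]. nra. }
  destruct (MVT_cor2 phi dphi 0 1 ltac:(lra) Hder) as (c & Hc & Hc01).
  assert (H1 : phi 1 = V z).
  { unfold phi. f_equal. extensionality i. unfold p, vadd, w, vsub. ring. }
  assert (H0 : phi 0 = V y).
  { unfold phi. f_equal. extensionality i. unfold p, vadd. ring. }
  rewrite H1, H0, Rminus_0_r, Rmult_1_r in Hc. rewrite Hc.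
  assert (Hpc : vnorm n (vsub (p c) x0) < d).
  { apply Rle_lt_trans with ((1 - c) * vnorm n (vsub y x0) + c * vnorm n (vsub z x0)); [|nra].
    unfold vnorm, sum_lt. rewrite <- !sumL_scal, <- sumL_plus. apply sumL_le. intros i _.
    unfold vsub. replace (p c i - x0 i) with ((1 - c) * (y i - x0 i) + c * (z i - x0 i)).
    - eapply Rle_trans; [apply Rabs_triang|]. rewrite !Rabs_mult.
      rewrite (Rabs_pos_eq (1 - c)), (Rabs_pos_eq c); lra.
    - unfold p, vadd, w, vsub. ring. }
  unfold dphi, vnorm, sum_lt. rewrite <- sumL_scal.
  eapply Rle_trans; [apply sumL_abs|]. apply sumL_le. intros i Hi. rewrite Rabs_mult.
  apply Rmult_le_compat_r; [apply Rabs_pos|].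
  specialize (Hball i Hi _ Hpc). specialize (HdK i Hi). simpl in HdK.
  replace (dV (p c) i) with ((dV (p c) i - dV x0 i) + dV x0 i) by ring.
  eapply Rle_trans; [apply Rabs_triang|]. lra.
Qed.

(** * The chain rule and closure properties of [ACD] *)

Lemma derivable_pt_lim_sumL {A} (L : list A) (F : A -> R -> R) (D : A -> R) t :
  (forall i, In i L -> derivable_pt_lim (F i) t (D i)) ->
  derivable_pt_lim (fun s => sumL (fun i => F i s) L) t (sumL D L).
Proof.
  induction L as [|i L IH]; intros H; simpl.
  - apply derivable_pt_lim_const.
  - apply (derivable_pt_lim_plus (F i) (fun s => sumL (fun i => F i s) L)).
    + apply H; simpl; auto.
    + apply IH; intros; apply H; simpl; auto.
Qed.

(** The linear part is differentiated coordinatewise. The remainder is small compared with [h]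
    because near [t] each coordinate moves by at most [Rabs h] times [Rabs (D i) + 1]. *)
Lemma derivable_pt_lim_C1 n V dV (x : R -> vec) (D : vec) t :
  is_C1 n V dV -> (forall i, (i < n)%nat -> derivable_pt_lim (fun s => x s i) t (D i)) ->
  derivable_pt_lim (fun s => V (x s)) t (sum_lt n (fun i => dV (x t) i * D i)).
Proof.
  intros [HV _] HD eps He.
  assert (Hlin : derivable_pt_lim (fun s => sumL (fun i => dV (x t) i * x s i) (seq 0 n)) t
                   (sum_lt n (fun i => dV (x t) i * D i))).
  { apply derivable_pt_lim_sumL. intros i Hi. apply in_seq0 in Hi.
    apply derivable_pt_lim_scal. auto. }
  destruct (Hlin (eps/2)) as (r1 & Hr1); [lra|].
  set (C := sum_lt n (fun i => Rabs (D i) + 1)).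
  assert (HC : 0 <= C).
  { apply sumL_nonneg. intros i _. pose proof (Rabs_pos (D i)). lra. }
  destruct (HV (x t) (eps / 2 / (C + 1))) as (d & Hd & Hrem); [apply Rdiv_lt_0_compat; lra|].
  destruct (finite_radius (seq 0 n) (fun i r => forall h, Rabs h < r ->
              Rabs (x (t + h) i - x t i) <= Rabs h * (Rabs (D i) + 1))) as (r2 & Hr2 & Hinc).
  { intros i r r' H Hr h Hh. apply H; lra. }
  { intros i Hi. apply in_seq0 in Hi. destruct (HD i Hi 1 Rlt_0_1) as (r & Hr).
    exists r. split; [apply cond_pos|]. intros h Hh.
    destruct (Req_dec h 0) as [->|Hh0].
    - rewrite Rplus_0_r, Rminus_diag, Rabs_R0. lra.
    - specialize (Hr h Hh0 Hh).
      replace (x (t + h) i - x t i) with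
        (h * (((x (t + h) i - x t i) / h - D i) + D i)) by (field; auto).
      rewrite Rabs_mult. apply Rmult_le_compat_l; [apply Rabs_pos|].
      eapply Rle_trans; [apply Rabs_triang|]. lra. }
  assert (Hr3 : 0 < Rmin (Rmin r1 r2) (d / (C + 1))).
  { repeat apply Rmin_pos; auto; [apply cond_pos|apply Rdiv_lt_0_compat; lra]. }
  exists (mkposreal _ Hr3). simpl. intros h Hh0 Hh.
  pose proof (Rmin_l (Rmin r1 r2) (d / (C + 1))). pose proof (Rmin_r (Rmin r1 r2) (d / (C + 1))).
  pose proof (Rmin_l r1 r2). pose proof (Rmin_r r1 r2).
  specialize (Hr1 h Hh0 ltac:(lra)).
  assert (Hha : 0 < Rabs h) by now apply Rabs_pos_lt.
  assert (Hnorm : vnorm n (vsub (x (t + h)) (x t)) <= Rabs h * C).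
  { unfold C, vnorm, sum_lt. rewrite <- sumL_scal. apply sumL_le. intros i Hi.
    apply Hinc; auto. lra. }
  assert (Rabs h * (C + 1) < d).
  { apply Rlt_le_trans with (d / (C+1) * (C + 1)); [apply Rmult_lt_compat_r; lra|].
    right; field; lra. }
  specialize (Hrem (vsub (x (t+h)) (x t)) ltac:(lra)). rewrite vadd_vsub in Hrem.
  set (R0 := V (x (t + h)) - V (x t) - _) in Hrem.
  set (S := sum_lt n (fun i => dV (x t) i * D i)) in *.
  rewrite <- sumL_minus in Hr1.
  assert (Heq : (V (x (t + h)) - V (x t)) / h - S =
    R0 / h + (sumL (fun i => dV (x t) i * x (t + h) i - dV (x t) i * x t i) (seq 0 n) / h - S)).
  { unfold R0. unfold sum_lt.
    rewrite (sumL_ext (fun i => dV (x t) i * vsub (x (t+h)) (x t) i)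
      (fun i => dV (x t) i * x (t + h) i - dV (x t) i * x t i)).
    - field; auto.
    - intros; unfold vsub; ring. }
  rewrite Heq. eapply Rle_lt_trans; [apply Rabs_triang|].
  assert (Rabs (R0 / h) <= eps / 2); [|lra].
  unfold Rdiv at 1. rewrite Rabs_mult, Rabs_inv.
  apply Rmult_le_reg_r with (Rabs h); auto. rewrite Rmult_assoc, Rinv_l by lra.
  rewrite Rmult_1_r. eapply Rle_trans; [exact Hrem|].
  apply Rle_trans with (eps / 2 / (C+1) * (Rabs h * (C + 1))); [|right; field; lra].
  apply Rmult_le_compat_l; [left; apply Rdiv_lt_0_compat; lra|]. nra.
Qed.

Lemma ACD_ext Z h h' D D' : (forall t, h t = h' t) -> (forall t, 0 <= t -> ~ Z t -> D t = D' t) ->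
  ACD Z h D -> ACD Z h' D'.
Proof.
  intros Hh HD. replace h' with h by (extensionality t; auto). intros [H1 H2].
  split; auto. intros t Ht Hz. rewrite <- HD; auto.
Qed.

Lemma ACD_sum {A} Z (L : list A) (x D : A -> R -> R) :
  (forall i, In i L -> ACD Z (x i) (D i)) ->
  ACD Z (fun t => sumL (fun i => x i t) L) (fun t => sumL (fun i => D i t) L).
Proof.
  intros H. split.
  - intros t Ht. destruct (ACD_family Z L x D t H Ht) as (r & Hr & Hac).
    exists r; split; auto. intros a b Ha Hta Hab Hb.
    apply (abs_cont_on_lipschitz L x _ 1); [intros; apply Hac; auto|].
    intros c d _ _ _. rewrite <- sumL_minus, Rmult_1_l. apply sumL_abs.
  - intros t Ht Hz. apply derivable_pt_lim_sumL. intros i Hi. apply H; auto.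
Qed.

(** [V] is Lipschitz only in a ball around [x t], and by continuity the curve remains there for a
    short time. This is why [ACD] asks for absolute continuity locally. *)
Lemma ACD_C1 Z n V dV (x D : R -> vec) :
  is_C1 n V dV -> (forall i, (i < n)%nat -> ACD Z (fun t => x t i) (fun t => D t i)) ->
  ACD Z (fun t => V (x t)) (fun t => sum_lt n (fun i => dV (x t) i * D t i)).
Proof.
  intros HV H. split.
  - intros t Ht. destruct (C1_locally_lipschitz n V dV (x t) HV) as (d & K & Hd & HK).
    assert (H' : forall i, In i (seq 0 n) -> ACD Z (fun t => x t i) (fun t => D t i)).
    { intros i Hi; apply H; now apply in_seq0. }
    destruct (ACD_family Z _ _ _ t H' Ht) as (r & Hr & Hac).
    (* The added 1 allows [n = 0] and makes the sum of [n] such bounds strictly less than [d]. *)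
    assert (HN : 0 < d / (INR n + 1)).
    { apply Rdiv_lt_0_compat; auto. pose proof (pos_INR n). lra. }
    destruct (finite_radius (seq 0 n) (fun i r => forall s, 0 <= s -> Rabs (s - t) < r ->
                Rabs (x s i - x t i) < d / (INR n + 1))) as (r' & Hr' & Hclose).
    { intros i r1 r2 Hr1 Hr2 s Hs1 Hs2. apply Hr1; lra. }
    { intros i Hi. apply (ACD_cont _ _ _ t (H' i Hi)); auto. }
    assert (Hball : forall s, 0 <= s -> Rabs (s - t) < r' -> vnorm n (vsub (x s) (x t)) < d).
    { intros s Hs Hst.
      eapply Rle_lt_trans; [apply (sumL_bound _ _ (d / (INR n + 1)))|].
      - intros i Hi. left. apply Hclose; auto.
      - rewrite length_seq. apply Rlt_le_trans with ((INR n + 1) * (d / (INR n + 1))).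
        + apply Rmult_lt_compat_r; lra.
        + right; field. pose proof (pos_INR n). lra. }
    exists (Rmin r r'). split; [apply Rmin_pos; auto|]. intros a b Ha Hta Hab Hb.
    pose proof (Rmin_l r r'). pose proof (Rmin_r r r').
    apply (abs_cont_on_lipschitz (seq 0 n) (fun i t => x t i) _ K).
    + intros; apply Hac; auto; lra.
    + intros c e Hc Hce He. apply HK; apply Hball; try lra; apply Rabs_def1; lra.
  - intros t Ht Hz. apply derivable_pt_lim_C1; auto. intros i Hi. apply H; auto.
Qed.

(** With this lemma and [is_C1_mult], compositions and products become instances of [ACD_C1]. *)
Lemma is_C1_scalar (F F' : R -> R) :
  (forall x, derivable_pt_lim F x (F' x)) -> continuity F' ->
  is_C1 1 (fun v => F (v 0%nat)) (fun v _ => F' (v 0%nat)).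
Proof.
  intros HF HF'. split.
  - intros x eps He. destruct (HF (x 0%nat) eps He) as (d & H).
    exists d. split; [apply cond_pos|]. intros h Hh.
    unfold vnorm, sum_lt in *. simpl in *. rewrite !Rplus_0_r in *. unfold vadd.
    destruct (Req_dec (h 0%nat) 0) as [->|Hh0].
    + rewrite Rabs_R0, !Rplus_0_r, !Rmult_0_r, Rminus_diag, Rminus_0_r, Rabs_R0. lra.
    + specialize (H _ Hh0 Hh).
      match goal with |- Rabs ?u <= _ => replace u with
       (((F (x 0%nat + h 0%nat) - F (x 0%nat)) / h 0%nat - F' (x 0%nat)) * h 0%nat) by (field; auto) end.
      rewrite Rabs_mult. apply Rmult_le_compat_r; [apply Rabs_pos|lra].
  - intros i _ x eps He. destruct (HF' (x 0%nat) eps He) as (d & Hd & H).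
    exists d. split; auto. intros y Hy.
    unfold vnorm, sum_lt, vsub in Hy. simpl in Hy. rewrite Rplus_0_r in Hy.
    destruct (Req_dec (y 0%nat) (x 0%nat)) as [->|Hn].
    + rewrite Rminus_diag, Rabs_R0. lra.
    + apply (H (y 0%nat)). split; [|exact Hy]. split; [exact I|auto].
Qed.

Lemma ACD_comp Z (F F' h D : R -> R) :
  (forall x, derivable_pt_lim F x (F' x)) -> continuity F' -> ACD Z h D ->
  ACD Z (fun t => F (h t)) (fun t => F' (h t) * D t).
Proof.
  intros HF HF' Hh.
  eapply ACD_ext; [| |apply (ACD_C1 Z 1 _ _ (fun t _ => h t) (fun t _ => D t) (is_C1_scalar _ _ HF HF'))].
  - reflexivity.
  - intros. unfold sum_lt; simpl. ring.
  - auto.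
Qed.

Lemma is_C1_mult :
  is_C1 2 (fun v => v 0%nat * v 1%nat) (fun v i => match i with O => v 1%nat | _ => v 0%nat end).
Proof.
  split.
  - intros x eps He. exists eps. split; auto. intros h Hh.
    unfold vnorm, sum_lt, vadd in *. simpl in *. rewrite !Rplus_0_r in *.
    match goal with |- Rabs ?u <= _ => replace u with (h 0%nat * h 1%nat) by ring end.
    rewrite Rabs_mult. pose proof (Rabs_pos (h 0%nat)). pose proof (Rabs_pos (h 1%nat)). nra.
  - intros i Hi x eps He. exists eps. split; auto. intros y Hy.
    pose proof (vnorm_elem 2 (vsub y x) 0 ltac:(lia)).
    pose proof (vnorm_elem 2 (vsub y x) 1 ltac:(lia)). unfold vsub in *.
    destruct i; lra.
Qed.

Lemma ACD_mult Z h1 h2 D1 D2 : ACD Z h1 D1 -> ACD Z h2 D2 ->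
  ACD Z (fun t => h1 t * h2 t) (fun t => D1 t * h2 t + h1 t * D2 t).
Proof.
  intros H1 H2.
  eapply ACD_ext; [| |apply (ACD_C1 Z 2 _ _ (fun t i => match i with O => h1 t | _ => h2 t end)
     (fun t i => match i with O => D1 t | _ => D2 t end) is_C1_mult)].
  - reflexivity.
  - intros. unfold sum_lt; simpl. ring.
  - intros [|i] _; auto.
Qed.

Lemma ACD_id Z : ACD Z (fun t => t) (fun _ => 1).
Proof.
  split.
  - intros t _. exists 1; split; [lra|]. intros a b _ _ _ _ eps He. exists eps; split; auto.
    intros l Hl Hlen. rewrite (sumL_ext _ (fun p => snd p - fst p)); auto.
    intros p Hp. apply (ordered_in_In _ _ _ _ Hl) in Hp. apply Rabs_pos_eq. lra.
  - intros t _ _. apply derivable_pt_lim_id.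
Qed.

Lemma ACD_const Z c : ACD Z (fun _ => c) (fun _ => 0).
Proof.
  eapply ACD_ext; [| |apply (ACD_comp Z (fun _ => c) (fun _ => 0) (fun t => t) (fun _ => 1))].
  5: apply ACD_id.
  - reflexivity.
  - intros; simpl; ring.
  - intros; apply derivable_pt_lim_const.
  - apply continuity_const. intros ? ?; auto.
Qed.

Lemma ACD_plus Z h1 h2 D1 D2 : ACD Z h1 D1 -> ACD Z h2 D2 ->
  ACD Z (fun t => h1 t + h2 t) (fun t => D1 t + D2 t).
Proof.
  intros H1 H2.
  eapply ACD_ext; [| |apply (ACD_sum Z [true; false] (fun b : bool => if b then h1 else h2)
     (fun b : bool => if b then D1 else D2))].
  - intros; simpl; ring.
  - intros; simpl; ring.
  - intros [] _; auto.
Qed.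

Lemma ACD_scal Z c h D : ACD Z h D -> ACD Z (fun t => c * h t) (fun t => c * D t).
Proof.
  intros H. eapply ACD_ext; [| |apply (ACD_mult Z _ _ _ _ (ACD_const Z c) H)].
  - reflexivity.
  - intros; simpl; ring.
Qed.

Lemma ACD_minus Z h1 h2 D1 D2 : ACD Z h1 D1 -> ACD Z h2 D2 ->
  ACD Z (fun t => h1 t - h2 t) (fun t => D1 t - D2 t).
Proof.
  intros H1 H2.
  eapply ACD_ext; [| |apply (ACD_plus Z _ _ _ _ H1 (ACD_scal Z (-1) _ _ H2))];
  intros; simpl; ring.
Qed.

Lemma ACD_growth_ge Z h D a b c :
  null_set Z -> ACD Z h D -> 0 <= a -> a <= b ->
  (forall t, a <= t <= b -> ~ Z t -> c <= D t) -> c * (b - a) <= h b - h a.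
Proof.
  intros HZ Hh Ha Hab HD.
  pose proof (ACD_growth Z _ _ a b (-c) HZ (ACD_scal Z (-1) _ _ Hh) Ha Hab) as H.
  enough (-1 * h b - -1 * h a <= - c * (b - a)) by lra.
  apply H. intros t Ht Hz. specialize (HD t Ht Hz). lra.
Qed.

(** * Compactness *)

(** Subsequences are index maps with [k <= s k], not necessarily increasing: this suffices for
    limits and is stable under composition. *)
Lemma Un_cv_subseq (u : nat -> R) (s : nat -> nat) l :
  (forall k, (k <= s k)%nat) -> Un_cv u l -> Un_cv (fun k => u (s k)) l.
Proof.
  intros Hs H eps He. destruct (H eps He) as (N & HN). exists N. intros k Hk.
  apply HN. specialize (Hs k). lia.
Qed.

Lemma inv_INR_small eps : 0 < eps -> exists N, forall n, (N <= n)%nat -> / (INR n + 1) < eps.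
Proof.
  intros He. destruct (archimed_cor1 eps He) as (N & HN & HN0). exists N. intros n Hn.
  apply Rle_lt_trans with (/ INR N); auto. apply Rinv_le_contravar.
  - now apply lt_0_INR.
  - apply le_INR in Hn. lra.
Qed.

Lemma bounded_subseq (u : nat -> R) r : (forall n, Rabs (u n) <= r) ->
  exists (s : nat -> nat) l, (forall k, (k <= s k)%nat) /\ Un_cv (fun k => u (s k)) l.
Proof.
  intros Hu. destruct (Bolzano_Weierstrass u (fun c => - r <= c <= r)) as (l & Hl).
  - apply compact_P3.
  - intros n. specialize (Hu n). pose proof (Rle_abs (u n)). pose proof (Rle_abs (- u n)) as H'.
    rewrite Rabs_Ropp in H'. lra.
  - assert (Hex : forall k, exists p, (k <= p)%nat /\ Rabs (u p - l) < / (INR k + 1)).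
    { intros k. assert (Hp : 0 < / (INR k + 1)).
      { apply Rinv_0_lt_compat. pose proof (pos_INR k). lra. }
      destruct (Hl (disc l (mkposreal _ Hp)) k) as (p & Hp1 & Hp2).
      - exists (mkposreal _ Hp). intros y Hy; exact Hy.
      - exists p; split; auto. }
    apply functional_choice in Hex. destruct Hex as (s & Hs).
    exists s, l. split; [intros; apply Hs|]. intros eps He.
    destruct (inv_INR_small eps He) as (N & HN). exists N. intros n Hn.
    unfold R_dist. eapply Rlt_trans; [apply Hs|]. apply HN; auto.
Qed.

Lemma bounded_subseq_family {A} (L : list A) (u : nat -> A -> R) r :
  (forall n a, In a L -> Rabs (u n a) <= r) ->
  exists (s : nat -> nat) (l : A -> R), (forall k, (k <= s k)%nat) /\
    forall a, In a L -> Un_cv (fun k => u (s k) a) (l a).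
Proof.
  induction L as [|a L IH]; intros Hu.
  - exists (fun k => k), (fun _ => 0). split; [auto|intros _ []].
  - destruct IH as (s & l & Hs & Hl); [intros; apply Hu; simpl; auto|].
    destruct (bounded_subseq (fun k => u (s k) a) r) as (s' & la & Hs' & Hla).
    { intros; apply Hu; simpl; auto. }
    exists (fun k => s (s' k)), (fun b => if excluded_middle_informative (b = a) then la else l b).
    split. { intros k. specialize (Hs' k). specialize (Hs (s' k)). lia. }
    intros b Hb. destruct (excluded_middle_informative (b = a)) as [->|Hn]; auto.
    destruct Hb as [->|Hb]; [tauto|].
    apply (Un_cv_subseq (fun k => u (s k) b)); auto.
Qed.

Lemma Un_cv_norm {A} (L : list A) (u : nat -> A -> R) l :
  (forall a, In a L -> Un_cv (fun k => u k a) (l a)) ->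
  Un_cv (fun k => sumL (fun a => Rabs (u k a - l a)) L) 0.
Proof.
  induction L as [|a L IH]; intros H; simpl.
  - intros eps He. exists 0%nat. intros. unfold R_dist. rewrite Rminus_0_r, Rabs_R0. auto.
  - replace 0 with (0 + 0) by ring. apply (CV_plus (fun k => Rabs (u k a - l a))).
    + intros eps He. destruct (H a (or_introl eq_refl) eps He) as (N & HN). exists N.
      intros n Hn. unfold R_dist. rewrite Rminus_0_r, Rabs_Rabsolu. apply HN; auto.
    + apply IH. intros; apply H; simpl; auto.
Qed.

(** * The state space *)

(** Names the real coordinates of a state, so that distances, subsequences and velocity bounds run
    over the single list [coords] instead of three families. *)
Inductive coord := Ceta (e : edge) | Com (j : nat) | Cxs (j i : nat).

Definition val (x : state) (c : coord) : R :=
  match c with Ceta e => eta x e | Com j => omega x j | Cxs j i => xs x j i end.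

Definition of_coords (v : coord -> R) : state :=
  mkState (fun e => v (Ceta e)) (fun j => v (Com j)) (fun j i => v (Cxs j i)).

Definition coords (nN : nat) (E : list edge) (nd : nat -> nat) : list coord :=
  map Ceta E ++ map Com (seq 0 nN)
  ++ flat_map (fun j => map (Cxs j) (seq 0 (nd j))) (seq 0 nN).

Lemma val_of_coords v c : val (of_coords v) c = v c.
Proof. now destruct c. Qed.

Lemma sumL_flat_map {A B} (F : B -> R) (h : A -> list B) L :
  sumL F (flat_map h L) = sumL (fun a => sumL F (h a)) L.
Proof. induction L as [|a L IH]; simpl; auto. rewrite sumL_app, IH. reflexivity. Qed.

Section StateSpace.
Context (nN : nat) (E : list edge) (nd : nat -> nat).

Lemma sdist_coords x y :
  sdist nN E nd x y = sumL (fun c => Rabs (val x c - val y c)) (coords nN E nd).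
Proof.
  unfold sdist, snorm, coords, vnorm, sum_lt. rewrite !sumL_app, !map_map, sumL_flat_map. simpl.
  rewrite <- Rplus_assoc. f_equal. apply sumL_ext. intros j _. now rewrite map_map.
Qed.

Lemma in_coords_eta e : In e E -> In (Ceta e) (coords nN E nd).
Proof. intros. apply in_or_app. left. now apply in_map. Qed.

Lemma in_coords_om j : (j < nN)%nat -> In (Com j) (coords nN E nd).
Proof.
  intros. apply in_or_app. right. apply in_or_app. left. apply in_map. now apply in_seq0.
Qed.

Lemma in_coords_xs j i : (j < nN)%nat -> (i < nd j)%nat -> In (Cxs j i) (coords nN E nd).
Proof.
  intros. apply in_or_app. right. apply in_or_app. right. apply in_flat_map. exists j.
  split; [now apply in_seq0|]. apply in_map. now apply in_seq0.
Qed.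

Lemma in_coords_inv (P : coord -> Prop) :
  (forall e, In e E -> P (Ceta e)) -> (forall j, (j < nN)%nat -> P (Com j)) ->
  (forall j i, (j < nN)%nat -> (i < nd j)%nat -> P (Cxs j i)) ->
  forall c, In c (coords nN E nd) -> P c.
Proof.
  intros H1 H2 H3 c Hc. apply in_app_or in Hc as [Hc|Hc].
  - apply in_map_iff in Hc as (e & <- & He). auto.
  - apply in_app_or in Hc as [Hc|Hc].
    + apply in_map_iff in Hc as (j & <- & Hj). apply in_seq0 in Hj. auto.
    + apply in_flat_map in Hc as (j & Hj & Hc). apply in_map_iff in Hc as (i & <- & Hi).
      apply in_seq0 in Hj, Hi. auto.
Qed.

Lemma sdist_nonneg x y : 0 <= sdist nN E nd x y.
Proof. rewrite sdist_coords. apply sumL_nonneg; intros; apply Rabs_pos. Qed.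

Lemma sdist_sym x y : sdist nN E nd x y = sdist nN E nd y x.
Proof. rewrite !sdist_coords. apply sumL_ext. intros; apply Rabs_minus_sym. Qed.

Lemma sdist_triang x y z : sdist nN E nd x z <= sdist nN E nd x y + sdist nN E nd y z.
Proof.
  rewrite !sdist_coords, <- sumL_plus. apply sumL_le. intros c _.
  replace (val x c - val z c) with ((val x c - val y c) + (val y c - val z c)) by ring.
  apply Rabs_triang.
Qed.

Lemma sdist_refl x : sdist nN E nd x x = 0.
Proof.
  rewrite sdist_coords. apply sumL_zero. intros. rewrite Rminus_diag. apply Rabs_R0.
Qed.

Lemma sdist_val x y c : In c (coords nN E nd) -> Rabs (val x c - val y c) <= sdist nN E nd x y.
Proof.
  intros. rewrite sdist_coords.
  apply (sumL_elem_le (fun c => Rabs (val x c - val y c))); auto. intros; apply Rabs_pos.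
Qed.

Lemma sdist_om x y j : (j < nN)%nat -> Rabs (omega x j - omega y j) <= sdist nN E nd x y.
Proof. intros H. apply (sdist_val x y (Com j)). now apply in_coords_om. Qed.

Lemma sdist_eta x y e : In e E -> Rabs (eta x e - eta y e) <= sdist nN E nd x y.
Proof. intros H. apply (sdist_val x y (Ceta e)). now apply in_coords_eta. Qed.

Lemma sdist_xs x y j : (j < nN)%nat -> vnorm (nd j) (vsub (xs x j) (xs y j)) <= sdist nN E nd x y.
Proof.
  intros H. unfold sdist, snorm. simpl.
  pose proof (sumL_nonneg (fun e => Rabs (eta x e - eta y e)) E (fun _ _ => Rabs_pos _)).
  pose proof (sumL_nonneg (fun j => Rabs (omega x j - omega y j)) (seq 0 nN) (fun _ _ => Rabs_pos _)).
  pose proof (sumL_elem_le (fun j => vnorm (nd j) (vsub (xs x j) (xs y j))) (seq 0 nN) j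
    (fun _ _ => vnorm_nonneg _ _)). apply in_seq0 in H. specialize (H2 H).
  unfold sum_lt. simpl in *. lra.
Qed.

Definition sconv (u : nat -> state) (p : state) : Prop :=
  Un_cv (fun k => sdist nN E nd (u k) p) 0.

(** Sequential, because compactness is used through subsequences. Since [sdist] is only a
    pseudo-distance, such an [F] takes equal values at states that agree on [coords]. *)
Definition scont (F : state -> R) : Prop :=
  forall u p, sconv u p -> Un_cv (fun k => F (u k)) (F p).

Lemma sconv_eps u p : sconv u p -> forall eps, 0 < eps ->
  exists N, forall n, (N <= n)%nat -> sdist nN E nd (u n) p < eps.
Proof.
  intros H eps He. destruct (H eps He) as (N & HN). exists N. intros n Hn.
  specialize (HN n Hn). unfold R_dist in HN. rewrite Rminus_0_r in HN.
  eapply Rle_lt_trans; [apply Rle_abs|exact HN].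
Qed.

Lemma bounded_sconv_subseq (u : nat -> state) x0 r :
  (forall n, sdist nN E nd (u n) x0 <= r) ->
  exists s p, (forall k, (k <= s k)%nat) /\ sconv (fun k => u (s k)) p.
Proof.
  intros Hu.
  destruct (bounded_subseq_family (coords nN E nd) (fun n c => val (u n) c - val x0 c) r)
    as (s & l & Hs & Hl).
  { intros n c Hc. eapply Rle_trans; [apply sdist_val; auto|auto]. }
  exists s, (of_coords (fun c => l c + val x0 c)). split; auto.
  intros eps He.
  destruct (Un_cv_norm _ (fun k c => val (u (s k)) c - val x0 c) l Hl eps He) as (N & HN).
  exists N. intros n Hn. specialize (HN n Hn). rewrite sdist_coords.
  rewrite (sumL_ext _ (fun a => Rabs (val (u (s n)) a - val x0 a - l a))); auto.
  intros c _. rewrite val_of_coords. f_equal. ring.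
Qed.

Lemma scont_eps F x : scont F -> forall eps, 0 < eps ->
  exists d, 0 < d /\ forall y, sdist nN E nd y x < d -> Rabs (F y - F x) < eps.
Proof.
  intros HF eps He. apply NNPP. intros Hn.
  assert (H : forall k : nat, exists y, sdist nN E nd y x < / (INR k + 1) /\ eps <= Rabs (F y - F x)).
  { intros k. apply NNPP. intros Hk. apply Hn. exists (/ (INR k + 1)). split.
    - apply Rinv_0_lt_compat. pose proof (pos_INR k). lra.
    - intros y Hy. apply Rnot_le_lt. intros Hle. apply Hk. exists y; auto. }
  apply functional_choice in H. destruct H as (u & Hu).
  assert (Hc : sconv u x).
  { intros e He'. destruct (inv_INR_small e He') as (N & HN). exists N. intros n Hn'.
    unfold R_dist. rewrite Rminus_0_r, Rabs_pos_eq by apply sdist_nonneg.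
    eapply Rlt_trans; [apply Hu|]. apply HN; auto. }
  destruct (HF u x Hc eps He) as (N & HN). specialize (HN N (le_n N)). unfold R_dist in HN.
  destruct (Hu N). lra.
Qed.

Lemma scont_val c : In c (coords nN E nd) -> scont (fun y => val y c).
Proof.
  intros Hc u p Hu eps He. destruct (sconv_eps u p Hu eps He) as (N & HN).
  exists N. intros n Hn. eapply Rle_lt_trans; [apply sdist_val; auto|auto].
Qed.

Lemma scont_eta e : In e E -> scont (fun y => eta y e).
Proof. intros H. apply (scont_val (Ceta e)). now apply in_coords_eta. Qed.

Lemma scont_om j : (j < nN)%nat -> scont (fun y => omega y j).
Proof. intros H. apply (scont_val (Com j)). now apply in_coords_om. Qed.

Lemma scont_const c : scont (fun _ => c).
Proof. intros u p _ eps He. exists 0%nat. intros. now rewrite R_dist_eq. Qed.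

Lemma scont_plus F G : scont F -> scont G -> scont (fun y => F y + G y).
Proof. intros HF HG u p Hu. apply (CV_plus (fun k => F (u k)) (fun k => G (u k))); auto. Qed.

Lemma scont_mult F G : scont F -> scont G -> scont (fun y => F y * G y).
Proof. intros HF HG u p Hu. apply (CV_mult (fun k => F (u k)) (fun k => G (u k))); auto. Qed.

Lemma scont_minus F G : scont F -> scont G -> scont (fun y => F y - G y).
Proof. intros HF HG u p Hu. apply (CV_minus (fun k => F (u k)) (fun k => G (u k))); auto. Qed.

Lemma scont_sum {A} (L : list A) (F : A -> state -> R) :
  (forall a, In a L -> scont (F a)) -> scont (fun y => sumL (fun a => F a y) L).
Proof.
  induction L as [|a L IH]; intros H; simpl; [apply scont_const|].
  apply scont_plus; [apply H; simpl; auto|]. apply IH; intros; apply H; simpl; auto.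
Qed.

Lemma scont_comp (h : R -> R) F : continuity h -> scont F -> scont (fun y => h (F y)).
Proof. intros Hh HF u p Hu. apply continuity_seq; auto. Qed.

Lemma scont_xs (V : vec -> R) j : (j < nN)%nat ->
  (forall x eps, 0 < eps -> exists d, 0 < d /\ forall y, vnorm (nd j) (vsub y x) < d ->
     Rabs (V y - V x) < eps) -> scont (fun y => V (xs y j)).
Proof.
  intros Hj HV u p Hu eps He. destruct (HV (xs p j) eps He) as (d & Hd & H).
  destruct (sconv_eps u p Hu d Hd) as (N & HN). exists N. intros n Hn. apply H.
  eapply Rle_lt_trans; [apply sdist_xs; auto|auto].
Qed.

Lemma scont_lipschitz F K :
  (forall x y, Rabs (F y - F x) <= K * sdist nN E nd y x) -> scont F.
Proof.
  intros HF u p Hu eps He. set (K' := Rmax K 0 + 1).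
  assert (HK : K <= K' /\ 1 <= K') by (unfold K', Rmax; destruct (Rle_dec _ _); lra).
  destruct (sconv_eps u p Hu (eps / K')) as (N & HN); [apply Rdiv_lt_0_compat; lra|].
  exists N. intros n Hn. specialize (HN n Hn). specialize (HF p (u n)). unfold R_dist.
  pose proof (sdist_nonneg (u n) p).
  apply Rle_lt_trans with (K' * sdist nN E nd (u n) p); [nra|].
  apply Rlt_le_trans with (K' * (eps / K')); [apply Rmult_lt_compat_l; lra|].
  right; field; lra.
Qed.

Lemma input_dist x y j : (j < nN)%nat ->
  vnorm (nd j) (vsub (xs y j) (xs x j)) + Rabs (- omega y j - - omega x j) <= 2 * sdist nN E nd y x.
Proof.
  intros Hj. pose proof (sdist_xs y x j Hj). pose proof (sdist_om y x j Hj).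
  replace (- omega y j - - omega x j) with (- (omega y j - omega x j)) by ring.
  rewrite Rabs_Ropp. lra.
Qed.

Lemma scont_g (g : vec -> R -> R) j : (j < nN)%nat -> globally_lipschitz_g (nd j) g ->
  scont (fun y => g (xs y j) (- omega y j)).
Proof.
  intros Hj (L & HL). apply (scont_lipschitz _ (2 * Rmax L 0)). intros x y.
  eapply Rle_trans; [apply HL|]. pose proof (input_dist x y j Hj).
  pose proof (Rmax_l L 0). pose proof (Rmax_r L 0).
  pose proof (vnorm_nonneg (nd j) (vsub (xs y j) (xs x j))).
  pose proof (Rabs_pos (- omega y j - - omega x j)). nra.
Qed.

Lemma scont_f (f : vec -> R -> vec) j i : (j < nN)%nat -> (i < nd j)%nat ->
  globally_lipschitz_f (nd j) f -> scont (fun y => f (xs y j) (- omega y j) i).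
Proof.
  (* A single component of [f] is a globally Lipschitz scalar function, so it can take the place of
     the output [g]. *)
  intros Hj Hi (L & HL). apply (scont_g (fun v u => f v u i) j Hj). exists L. intros.
  eapply Rle_trans; [|apply HL].
  apply (vnorm_elem (nd j) (vsub (f x u) (f y v)) i Hi).
Qed.

Lemma scont_bounded F x0 r : scont F ->
  exists K, forall y, sdist nN E nd y x0 <= r -> Rabs (F y) <= K.
Proof.
  intros HF. apply NNPP. intros Hn.
  assert (H : forall k : nat, exists y, sdist nN E nd y x0 <= r /\ INR k < Rabs (F y)).
  { intros k. apply NNPP. intros Hk. apply Hn. exists (INR k). intros y Hy.
    apply Rnot_lt_le. intros Hlt. apply Hk. exists y; auto. }
  apply functional_choice in H. destruct H as (u & Hu).
  destruct (bounded_sconv_subseq u x0 r) as (s & p & Hs & Hp); [apply Hu|].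
  destruct (HF _ _ Hp 1 Rlt_0_1) as (N & HN).
  destruct (INR_unbounded (Rabs (F p) + 1)) as (m & Hm).
  specialize (HN (N + m)%nat ltac:(lia)). unfold R_dist in HN.
  destruct (Hu (s (N + m)%nat)) as [_ Hb]. specialize (Hs (N + m)%nat).
  assert (INR m <= INR (s (N + m)%nat)) by (apply le_INR; lia).
  pose proof (Rabs_triang_inv (F (u (s (N + m)%nat))) (F p)). lra.
Qed.

(** Otherwise points of [P] with [F] above - 1 / (k + 1) would accumulate at a point of [P] where
    [F] is not negative. Serves both the energy barrier and the uniform dissipation. *)
Lemma scont_neg_bound F (P : state -> Prop) x0 r : scont F ->
  (forall y, P y -> sdist nN E nd y x0 <= r) ->
  (forall u p, (forall n, P (u n)) -> sconv u p -> P p) ->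
  (forall y, P y -> F y < 0) -> exists c, 0 < c /\ forall y, P y -> F y <= - c.
Proof.
  intros HF Hb Hcl HP. apply NNPP. intros Hn.
  assert (H : forall k : nat, exists y, P y /\ - / (INR k + 1) < F y).
  { intros k. apply NNPP. intros Hk. apply Hn. exists (/ (INR k + 1)). split.
    - apply Rinv_0_lt_compat. pose proof (pos_INR k). lra.
    - intros y Hy. apply Rnot_lt_le. intros Hlt. apply Hk. exists y; auto. }
  apply functional_choice in H. destruct H as (u & Hu).
  destruct (bounded_sconv_subseq u x0 r) as (s & p & Hs & Hp); [intros; apply Hb, Hu|].
  assert (HPp : P p) by (apply (Hcl (fun k => u (s k))); auto; intros; apply Hu).
  specialize (HP p HPp).
  destruct (HF _ _ Hp (- F p / 2)) as (N & HN); [lra|].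
  destruct (inv_INR_small (- F p / 2)) as (m & Hm); [lra|].
  specialize (HN (N + m)%nat ltac:(lia)). unfold R_dist in HN.
  apply Rabs_def2 in HN. destruct (Hu (s (N + m)%nat)) as [_ Hq].
  specialize (Hs (N + m)%nat). specialize (Hm (s (N + m)%nat) ltac:(lia)). lra.
Qed.

Lemma sconv_sdist_le u p x0 r : (forall n, sdist nN E nd (u n) x0 <= r) -> sconv u p ->
  sdist nN E nd p x0 <= r.
Proof.
  intros H Hu. apply Rnot_lt_le. intros Hlt.
  destruct (sconv_eps u p Hu (sdist nN E nd p x0 - r)) as (N & HN); [lra|].
  specialize (HN N (le_n N)). specialize (H N).
  pose proof (sdist_triang p (u N) x0). rewrite (sdist_sym p (u N)) in H0. lra.
Qed.

Lemma sconv_sdist_ge u p x0 r : (forall n, r <= sdist nN E nd (u n) x0) -> sconv u p ->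
  r <= sdist nN E nd p x0.
Proof.
  intros H Hu. apply Rnot_lt_le. intros Hlt.
  destruct (sconv_eps u p Hu (r - sdist nN E nd p x0)) as (N & HN); [lra|].
  specialize (HN N (le_n N)). specialize (H N).
  pose proof (sdist_triang (u N) p x0). lra.
Qed.

End StateSpace.

(** * Gronwall estimates *)

Lemma ACD_exp_scal Z A : ACD Z (fun t => exp (A * t)) (fun t => exp (A * t) * A).
Proof.
  eapply ACD_ext; [| |apply (ACD_comp Z exp exp _ _ derivable_pt_lim_exp
    (derivable_continuous _ derivable_exp) (ACD_scal Z A _ _ (ACD_id Z)))].
  - reflexivity.
  - intros; simpl; ring.
Qed.

(** The product of q + k and exp (- A t) does not increase. *)
Lemma gronwall_forward Z q D A k a b : null_set Z -> ACD Z q D -> 0 <= a -> a <= b ->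
  (forall t, a <= t <= b -> ~ Z t -> D t <= A * (q t + k)) ->
  q b + k <= (q a + k) * exp (A * (b - a)).
Proof.
  intros HZ Hq Ha Hab HD.
  pose proof (ACD_mult Z _ _ _ _ (ACD_plus Z _ _ _ _ Hq (ACD_const Z k)) (ACD_exp_scal Z (- A))) as Hp.
  apply (ACD_growth Z _ _ a b 0 HZ) in Hp; auto.
  - replace (exp (A * (b - a))) with (exp (- A * a) * exp (A * b)).
    2:{ rewrite <- exp_plus. f_equal. ring. }
    replace (q b + k) with ((q b + k) * exp (- A * b) * exp (A * b)).
    2:{ rewrite Rmult_assoc, <- exp_plus. replace (- A * b + A * b) with 0 by ring.
        rewrite exp_0. ring. }
    rewrite <- Rmult_assoc. apply Rmult_le_compat_r; [left; apply exp_pos|]. lra.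
  - intros t Ht Hz. specialize (HD t Ht Hz). pose proof (exp_pos (- A * t)). nra.
Qed.

(** The product of q + k and exp (A t) does not decrease, which bounds the past by the present. *)
Lemma gronwall_backward Z q D A k a b : null_set Z -> ACD Z q D -> 0 <= a -> a <= b ->
  (forall t, a <= t <= b -> ~ Z t -> - (A * (q t + k)) <= D t) ->
  q a + k <= (q b + k) * exp (A * (b - a)).
Proof.
  intros HZ Hq Ha Hab HD.
  pose proof (ACD_mult Z _ _ _ _ (ACD_plus Z _ _ _ _ Hq (ACD_const Z k)) (ACD_exp_scal Z A)) as Hp.
  apply (ACD_growth_ge Z _ _ a b 0 HZ) in Hp; auto.
  - replace (exp (A * (b - a))) with (exp (A * b) * exp (- A * a)).
    2:{ rewrite <- exp_plus. f_equal. ring. }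
    replace (q a + k) with ((q a + k) * exp (A * a) * exp (- A * a)).
    2:{ rewrite Rmult_assoc, <- exp_plus. replace (A * a + - A * a) with 0 by ring.
        rewrite exp_0. ring. }
    rewrite <- Rmult_assoc. apply Rmult_le_compat_r; [left; apply exp_pos|]. lra.
  - intros t Ht Hz. specialize (HD t Ht Hz). pose proof (exp_pos (A * t)). nra.
Qed.

(** The Gronwall argument runs on a sum of squares, which is differentiable, while all hypotheses
    use the sum of absolute values. The induction uses that the square of a + S is at most twice the
    sum of the squares. *)
Lemma sq_sum_abs_le {A} (L : list A) :
  exists C, 0 < C /\ forall v : A -> R,
    sumL (fun a => Rabs (v a)) L * sumL (fun a => Rabs (v a)) L <= C * sumL (fun a => v a * v a) L.
Proof.
  induction L as [|a L (C & HC & H)].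
  - exists 1. split; [lra|]. intros v; simpl; lra.
  - exists (2 * (C + 1)). split; [lra|]. intros v. simpl. specialize (H v).
    set (S := sumL (fun a => Rabs (v a)) L) in *. set (Q := sumL (fun a => v a * v a) L) in *.
    assert (HQ : 0 <= Q) by (apply sumL_nonneg; intros; nra).
    assert (Ha : Rabs (v a) * Rabs (v a) = v a * v a).
    { rewrite <- Rabs_mult. apply Rabs_pos_eq. nra. }
    assert (0 <= (Rabs (v a) - S) * (Rabs (v a) - S)) by apply Rle_0_sqr.
    assert (0 <= v a * v a) by apply Rle_0_sqr. nra.
Qed.

Lemma sum_sq_le_sq_sum_abs {A} (L : list A) (v : A -> R) :
  sumL (fun a => v a * v a) L <= sumL (fun a => Rabs (v a)) L * sumL (fun a => Rabs (v a)) L.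
Proof.
  rewrite <- sumL_scal. apply sumL_le. intros a Ha.
  replace (v a * v a) with (Rabs (v a) * Rabs (v a)).
  2:{ rewrite <- Rabs_mult. apply Rabs_pos_eq. nra. }
  apply Rmult_le_compat_r; [apply Rabs_pos|].
  apply (sumL_elem_le (fun a => Rabs (v a))); auto. intros; apply Rabs_pos.
Qed.

Lemma derivable_continuity (F F' : R -> R) : (forall x, derivable_pt_lim F x (F' x)) -> continuity F.
Proof. intros H x. apply derivable_continuous_pt. exists (F' x). apply H. Qed.

(** Solutions of a Lipschitz equation have continuous derivatives, as [ACD_comp] demands of the
    shifted solution. *)
Lemma lipschitz_C1_solution n F phi i : (i < n)%nat -> ode_sol n F phi ->
  (exists L, forall x y, vnorm n (vsub (F x) (F y)) <= L * vnorm n (vsub x y)) ->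
  continuity (fun s => F (phi s) i).
Proof.
  intros Hi Hphi (L & HL) s eps He. set (L' := Rmax L 0 + 1).
  assert (HL' : L <= L' /\ 1 <= L') by (unfold L', Rmax; destruct (Rle_dec _ _); lra).
  set (N := INR n + 1). assert (HN : 0 < N) by (pose proof (pos_INR n); unfold N; lra).
  assert (Hq : 0 < eps / L' / N) by (repeat apply Rdiv_lt_0_compat; lra).
  destruct (finite_radius (seq 0 n) (fun k r => forall u, Rabs (u - s) < r ->
     Rabs (phi u k - phi s k) < eps / L' / N)) as (r & Hr & H).
  { intros k r r' H Hr u Hu. apply H; lra. }
  { intros k Hk. apply in_seq0 in Hk.
    destruct (derivable_continuity (fun s => phi s k) _ (fun t => Hphi t k Hk) s _ Hq) as (d & Hd & H).
    exists d. split; auto. intros u Hu. destruct (Req_dec u s) as [->|Hn].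
    - rewrite Rminus_diag, Rabs_R0. lra.
    - apply (H u). split; [split; [exact I|auto]|exact Hu]. }
  exists r. split; auto. intros u [_ Hu]. simpl in Hu |- *. unfold R_dist in *.
  eapply Rle_lt_trans; [apply (vnorm_elem n (vsub (F (phi u)) (F (phi s)))); eauto|].
  eapply Rle_lt_trans; [apply HL|].
  assert (Hv : vnorm n (vsub (phi u) (phi s)) <= INR n * (eps / L' / N)).
  { pose proof (sumL_bound (fun k => Rabs (vsub (phi u) (phi s) k)) (seq 0 n) (eps / L' / N)) as Hb.
    rewrite length_seq in Hb. apply Hb. intros k Hk. left. apply H; auto. }
  pose proof (vnorm_nonneg n (vsub (phi u) (phi s))).
  apply Rle_lt_trans with (L' * vnorm n (vsub (phi u) (phi s))); [nra|].
  apply Rle_lt_trans with (L' * (INR n * (eps / L' / N))); [apply Rmult_le_compat_l; lra|].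
  apply Rlt_le_trans with (L' * (N * (eps / L' / N))).
  - apply Rmult_lt_compat_l; [lra|]. apply Rmult_lt_compat_r; auto. unfold N; lra.
  - right. field. split; lra.
Qed.

(* Gronwall estimate, on both sides of [s0], for the squared Euclidean distance between [y] and
   the shifted solution [phi (. - s0)]. *)
Lemma asymptotic_solution_close Z n F phi (y dy : R -> vec) L t :
  null_set Z -> ode_sol n F phi ->
  (forall x z, vnorm n (vsub (F x) (F z)) <= L * vnorm n (vsub x z)) ->
  (forall i, (i < n)%nat -> ACD Z (fun s => y s i) (fun s => dy s i)) ->
  forall eps, 0 < eps -> exists e, 0 < e /\
    forall s0, 0 <= s0 - Rabs t ->
      (forall s, s0 - Rabs t <= s -> ~ Z s -> vnorm n (vsub (dy s) (F (y s))) <= e) ->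
      vnorm n (vsub (y s0) (phi 0)) <= e ->
      vnorm n (vsub (y (s0 + t)) (phi t)) < eps.
Proof.
  intros HZ Hphi HL Hy eps He.
  destruct (sq_sum_abs_le (seq 0 n)) as (C & HC & Hsq).
  set (L' := Rmax L 0).
  assert (HL' : L <= L' /\ 0 <= L') by (unfold L', Rmax; destruct (Rle_dec _ _); lra).
  (* The derivative of [q] is at most 2 N (e + L' N), hence at most (2 L' + 1) N^2 + e^2, and N^2 is
     at most C q. The final 1 absorbs e^2. *)
  set (A := (2 * L' + 1) * C + 1).
  assert (HA0 : 0 <= (2 * L' + 1) * C) by nra.
  (* Gronwall yields N^2 at most G e^2 at time [s0 + t]. With e = eps / (2 G) this is eps^2 / (4 G),
     below eps^2. Since [e] is fixed before [s0], it serves at arbitrarily late times. *)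
  set (G := 2 * C * exp (A * Rabs t) + 1).
  assert (HG : 1 <= G). { unfold G. pose proof (exp_pos (A * Rabs t)). nra. }
  exists (eps / (2 * G)). assert (Hee : 0 < eps / (2 * G)) by (apply Rdiv_lt_0_compat; lra).
  split; auto. set (e := eps / (2 * G)) in *. intros s0 Hs0 Hdy Hy0.
  set (z := fun s i => y s i - phi (s - s0) i).
  set (q := fun s => sumL (fun i => z s i * z s i) (seq 0 n)).
  set (Dz := fun s i => dy s i - F (phi (s - s0)) i).
  set (Dq := fun s => sumL (fun i => Dz s i * z s i + z s i * Dz s i) (seq 0 n)).
  assert (Hq : ACD Z q Dq).
  { apply (ACD_sum Z (seq 0 n) (fun i s => z s i * z s i) (fun i s => Dz s i * z s i + z s i * Dz s i)).
    intros i Hi. apply in_seq0 in Hi.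
    assert (Hz : ACD Z (fun s => z s i) (fun s => Dz s i)).
    { apply ACD_minus; [auto|].
      eapply ACD_ext; [| |apply (ACD_comp Z (fun s => phi s i) (fun s => F (phi s) i)
        (fun s => s - s0) (fun _ => 1 - 0))].
      - reflexivity.
      - intros; simpl; ring.
      - intros u; apply Hphi; auto.
      - apply (lipschitz_C1_solution n); auto. exists L; auto.
      - apply ACD_minus; [apply ACD_id|apply ACD_const]. }
    apply (ACD_mult Z _ _ _ _ Hz Hz). }
  set (N := fun s => sumL (fun i => Rabs (z s i)) (seq 0 n)).
  assert (HDq : forall s, s0 - Rabs t <= s -> ~ Z s -> Rabs (Dq s) <= A * (q s + e * e)).
  { intros s Hs Hz. specialize (Hdy s Hs Hz).
    assert (HN0 : 0 <= N s) by (apply sumL_nonneg; intros; apply Rabs_pos).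
    assert (Hq0 : 0 <= q s) by (apply sumL_nonneg; intros; apply Rle_0_sqr).
    assert (H1 : Rabs (Dq s) <= 2 * N s * sumL (fun i => Rabs (Dz s i)) (seq 0 n)).
    { rewrite <- sumL_scal. eapply Rle_trans; [apply sumL_abs|]. apply sumL_le. intros i Hi.
      replace (Dz s i * z s i + z s i * Dz s i) with (2 * (z s i * Dz s i)) by ring.
      rewrite !Rabs_mult, (Rabs_pos_eq 2) by lra. rewrite <- Rmult_assoc.
      apply Rmult_le_compat_r; [apply Rabs_pos|]. apply Rmult_le_compat_l; [lra|].
      apply (sumL_elem_le (fun i => Rabs (z s i))); auto. intros; apply Rabs_pos. }
    assert (H2 : sumL (fun i => Rabs (Dz s i)) (seq 0 n) <= e + L' * N s).
    { pose proof (vnorm_triang n (dy s) (F (y s)) (F (phi (s - s0)))) as Ht.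
      pose proof (HL (y s) (phi (s - s0))) as Hl.
      change (sumL (fun i => Rabs (Dz s i)) (seq 0 n)) with (vnorm n (vsub (dy s) (F (phi (s - s0))))).
      change (N s) with (vnorm n (vsub (y s) (phi (s - s0)))) in *. nra. }
    assert (H3 : N s * N s <= C * q s) by apply (Hsq (z s)).
    assert (H4 : Rabs (Dq s) <= 2 * N s * (e + L' * N s)).
    { eapply Rle_trans; [exact H1|]. apply Rmult_le_compat_l; lra. }
    assert (H5 : 0 <= (N s - e) * (N s - e)) by apply Rle_0_sqr.
    assert (H6 : 2 * N s * (e + L' * N s) <= (2 * L' + 1) * (N s * N s) + e * e) by nra.
    assert (H7 : (2 * L' + 1) * (N s * N s) <= (2 * L' + 1) * (C * q s)) by (apply Rmult_le_compat_l; lra).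
    unfold A. assert (0 <= e * e) by nra. nra. }
  assert (Hq0 : q s0 <= e * e).
  { unfold q. eapply Rle_trans; [apply sum_sq_le_sq_sum_abs|].
    assert (Hn : sumL (fun i => Rabs (z s0 i)) (seq 0 n) <= e).
    { unfold z. rewrite Rminus_diag. exact Hy0. }
    assert (0 <= sumL (fun i => Rabs (z s0 i)) (seq 0 n)) by (apply sumL_nonneg; intros; apply Rabs_pos).
    apply Rmult_le_compat; auto. }
  assert (Hqt : q (s0 + t) + e * e <= (q s0 + e * e) * exp (A * Rabs t)).
  { destruct (Rle_lt_dec 0 t) as [Ht|Ht].
    - rewrite Rabs_pos_eq in * by lra. replace (A * t) with (A * (s0 + t - s0)) by ring.
      apply (gronwall_forward Z q Dq); auto; try lra. intros s Hs Hz.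
      eapply Rle_trans; [apply Rle_abs|]. apply HDq; auto; lra.
    - rewrite Rabs_left in * by lra. replace (A * - t) with (A * (s0 - (s0 + t))) by ring.
      apply (gronwall_backward Z q Dq); auto; try lra. intros s Hs Hz.
      specialize (HDq s ltac:(lra) Hz). pose proof (Rle_abs (- Dq s)) as Hr.
      rewrite Rabs_Ropp in Hr. lra. }
  pose proof (Hsq (z (s0 + t))) as Hf.
  replace (vnorm n (vsub (y (s0 + t)) (phi t))) with (N (s0 + t)).
  2:{ unfold N, z, vnorm, sum_lt, vsub. replace (s0 + t - s0) with t by ring. reflexivity. }
  fold (N (s0 + t)) (q (s0 + t)) in Hf.
  pose proof (exp_pos (A * Rabs t)) as Hexp.
  assert (Hee2 : 0 < e * e) by nra.
  assert (Hb1 : q (s0 + t) <= 2 * (e * e) * exp (A * Rabs t)) by nra.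
  assert (Hb2 : N (s0 + t) * N (s0 + t) <= G * (e * e)).
  { eapply Rle_trans; [exact Hf|]. eapply Rle_trans; [apply Rmult_le_compat_l; [lra|exact Hb1]|].
    unfold G. nra. }
  assert (Hb3 : G * (e * e) * (4 * G) = eps * eps) by (unfold e; field; lra).
  apply Rnot_le_lt. intros Hle.
  assert (eps * eps <= N (s0 + t) * N (s0 + t)) by (apply Rmult_le_compat; lra).
  assert (0 < G * (e * e)) by nra. nra.
Qed.

(** * Sums over buses turned into sums over edges *)

Lemma sum_lt_select (w : nat -> R) (c : R) k n : (k < n)%nat ->
  sum_lt n (fun j => w j * (if Nat.eqb k j then c else 0)) = w k * c.
Proof.
  induction n as [|n IH]; intros Hk; [lia|].
  unfold sum_lt in *. rewrite seq_S, sumL_app. simpl.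
  destruct (Nat.eq_dec k n) as [->|Hn].
  - rewrite Nat.eqb_refl, sumL_zero.
    + ring.
    + intros j Hj. apply in_seq0 in Hj. destruct (Nat.eqb_spec n j); [lia|ring].
  - rewrite IH by lia. destruct (Nat.eqb_spec k n); [lia|ring].
Qed.

(** Each edge is filtered into exactly one bus: its tail when the key is [fst], its head when it is
    [snd]. *)
Lemma sum_by_key {A} (key : A -> nat) (w : nat -> R) (F : A -> R) n L :
  (forall a, In a L -> (key a < n)%nat) ->
  sum_lt n (fun j => w j * sumL F (filter (fun a => Nat.eqb (key a) j) L)) =
  sumL (fun a => w (key a) * F a) L.
Proof.
  induction L as [|a L IH]; intros H; simpl.
  - apply sumL_zero. intros; ring.
  - rewrite <- IH by (intros; apply H; simpl; auto).
    rewrite <- (sum_lt_select w (F a) (key a) n) by (apply H; simpl; auto).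
    unfold sum_lt. rewrite <- sumL_plus. apply sumL_ext. intros j _.
    destruct (Nat.eqb (key a) j); simpl; ring.
Qed.

(** * The network *)

Lemma Fdc_passive lo hi wl wh w v :
  lo <= 0 <= hi -> wl < 0 < wh -> Fdc lo hi wl wh w v -> 0 <= w * v.
Proof.
  intros Hd Hw [(-> & H)|[(-> & H)|(H1 & H2 & ->)]]; [nra|nra|].
  unfold fc. destruct (Rlt_dec wh w); [nra|]. destruct (Rlt_dec wl w); nra.
Qed.

(** Applied where the frequency is 0 (equilibria) or already small (late times): there the selection
    [v] is determined. *)
Lemma Fdc_dead_band lo hi wl wh w v : wl < w < wh -> Fdc lo hi wl wh w v <-> v = 0.
Proof.
  intros Hw. unfold Fdc, fc. split.
  - intros [(-> & H)|[(-> & H)|(H1 & H2 & ->)]]; try lra.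
    destruct (Rlt_dec wh w); [lra|]. destruct (Rlt_dec wl w); lra.
  - intros ->. right; right. repeat split; try lra.
    destruct (Rlt_dec wh w); [lra|]. destruct (Rlt_dec wl w); lra.
Qed.

Lemma Fdc_bound lo hi wl wh w v : lo <= 0 <= hi -> Fdc lo hi wl wh w v -> Rabs v <= hi - lo.
Proof.
  intros Hd H. apply Rabs_le. destruct H as [(-> & H)|[(-> & H)|(H1 & H2 & ->)]]; [lra|lra|].
  unfold fc. destruct (Rlt_dec wh w); [lra|]. destruct (Rlt_dec wl w); lra.
Qed.

(** The integral of b (sin u - sin h0) for [u] from [h0] to [h], that is, the line potential minus
    its tangent at [h0]. *)
Definition edge_energy (b h0 h : R) : R := b * (cos h0 - cos h - sin h0 * (h - h0)).

Lemma edge_energy_refl b h : edge_energy b h h = 0.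
Proof. unfold edge_energy. ring. Qed.

Lemma derivable_edge_energy b h0 h : derivable_pt_lim (edge_energy b h0) h (b * (sin h - sin h0)).
Proof.
  unfold edge_energy.
  apply (derivable_pt_lim_scal (fun h => cos h0 - cos h - sin h0 * (h - h0))).
  replace (sin h - sin h0) with ((0 - (- sin h)) - sin h0 * (1 - 0)) by ring.
  apply (derivable_pt_lim_minus (fun h => cos h0 - cos h) (fun h => sin h0 * (h - h0))).
  - apply (derivable_pt_lim_minus (fun _ => cos h0) cos);
      [apply derivable_pt_lim_const|apply derivable_pt_lim_cos].
  - apply (derivable_pt_lim_scal (fun h => h - h0)).
    apply (derivable_pt_lim_minus (fun h => h) (fun _ => h0));
      [apply derivable_pt_lim_id|apply derivable_pt_lim_const].
Qed.

(** The sine increases strictly between - PI / 2 and PI / 2, so the derivative has the sign of h -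
    h0. This is the use of (A4). *)
Lemma edge_energy_pos b h0 h : 0 < b -> Rabs h0 < PI / 2 -> Rabs h < PI / 2 -> h <> h0 ->
  0 < edge_energy b h0 h.
Proof.
  intros Hb H0 H Hn. apply Rabs_def2 in H0, H. rewrite <- (edge_energy_refl b h0) at 1.
  destruct (Rtotal_order h h0) as [Hlt|[->|Hlt]]; [|tauto|].
  - destruct (MVT_cor2 (edge_energy b h0) _ h h0 Hlt (fun c _ => derivable_edge_energy b h0 c))
      as (c & Hc & Hc'). assert (sin c < sin h0) by (apply sin_increasing_1; lra).
    assert (0 < b * (sin h0 - sin c) * (h0 - h)) by (repeat apply Rmult_lt_0_compat; lra). lra.
  - destruct (MVT_cor2 (edge_energy b h0) _ h0 h Hlt (fun c _ => derivable_edge_energy b h0 c))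
      as (c & Hc & Hc'). assert (sin h0 < sin c) by (apply sin_increasing_1; lra).
    assert (0 < b * (sin c - sin h0) * (h - h0)) by (repeat apply Rmult_lt_0_compat; lra). lra.
Qed.

Section Network.
Context (nN : nat) (E : list edge) (nd : nat -> nat)
  (M pL : nat -> R) (B : edge -> R)
  (f : nat -> vec -> R -> vec) (g : nat -> vec -> R -> R)
  (dlo dhi wlo whi : nat -> R)
  (HG : valid_graph nN E)
  (HM : forall j, (j < nN)%nat -> 0 < M j)
  (HB : forall e, In e E -> 0 < B e)
  (Hd : forall j, (j < nN)%nat -> dlo j <= 0 <= dhi j)
  (Hw : forall j, (j < nN)%nat -> wlo j < 0 < whi j)
  (Hf : forall j, (j < nN)%nat -> globally_lipschitz_f (nd j) (f j))
  (Hg : forall j, (j < nN)%nat -> globally_lipschitz_g (nd j) (g j)).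

Local Notation dist := (sdist nN E nd).
Local Notation equilibrium := (is_equilibrium nN E nd M pL B f g dlo dhi wlo whi).
Local Notation Q := (Qmap nN E nd M pL B f g dlo dhi wlo whi).

(** The value of M_j omega_j' when the on-off load is 0; this is the part that depends continuously
    on the state. *)
Definition power_balance (y : state) (j : nat) : R :=
  - pL j + g j (xs y j) (- omega y j) - flow_out E B y j + flow_in E B y j.

Lemma edge_ends e : In e E -> (fst e < nN)%nat /\ (snd e < nN)%nat.
Proof. destruct e. apply HG. Qed.

Lemma scont_flow (P : edge -> bool) :
  scont nN E nd (fun y => sumL (fun e => B e * sin (eta y e)) (filter P E)).
Proof.
  apply scont_sum. intros e He. apply filter_In in He as [He _].
  apply scont_mult; [apply scont_const|]. apply (scont_comp _ _ _ sin); [apply continuity_sin|].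
  now apply scont_eta.
Qed.

Lemma scont_power_balance j : (j < nN)%nat -> scont nN E nd (fun y => power_balance y j).
Proof.
  intros Hj. apply scont_plus; [|apply scont_flow]. apply scont_minus; [|apply scont_flow].
  apply scont_plus; [apply scont_const|]. apply scont_g; auto.
Qed.

Lemma equilibrium_iff_balance y : (forall j, (j < nN)%nat -> omega y j = 0) ->
  (equilibrium y <-> (forall j, (j < nN)%nat -> power_balance y j = 0 /\
     forall i, (i < nd j)%nat -> f j (xs y j) (- omega y j) i = 0)).
Proof.
  intros H0. unfold is_equilibrium, Qmap. simpl. split.
  - intros (_ & Hom & Hxs) j Hj. split; [|intros i Hi; symmetry; apply Hxs; auto].
    destruct (Hom j Hj) as (v & Hv & Heq). apply Fdc_dead_band in Hv; [|rewrite H0; auto].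
    specialize (HM j Hj). subst v. unfold power_balance.
    apply Rmult_eq_reg_l with (/ M j); [lra|]. apply Rinv_neq_0_compat. lra.
  - intros H. repeat split.
    + intros i j Hij. destruct (edge_ends (i, j) Hij) as [Hi Hj]. simpl in Hi, Hj. rewrite !H0 by auto. lra.
    + intros j Hj. exists 0. split; [apply Fdc_dead_band; auto; rewrite H0; auto|].
      destruct (H j Hj) as [Hb _]. unfold power_balance in Hb.
      replace (_ - 0 - _ + _) with 0 by lra. ring.
    + intros j Hj i Hi. symmetry. apply H; auto.
Qed.

(** * The equilibrium, its energy function and a ball where passivity holds *)

Context
  (HA2 : exists j, (j < nN)%nat /\ forall (xb : vec) (wb : R),
            (forall i, (i < nd j)%nat -> f j xb (- wb) i = 0) -> wb = 0)
  (xstar : state) (Heq : equilibrium xstar)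
  (HA4 : forall e, In e E -> Rabs (eta xstar e) < PI / 2).

(** Zero velocity of [eta] makes the frequencies equal across every edge, hence equal everywhere by
    connectedness; the bus of (A2) forces the common value to be 0. *)
Lemma omega_star_zero j : (j < nN)%nat -> omega xstar j = 0.
Proof.
  intros Hj. destruct Heq as (He & _ & Hx). destruct HA2 as (k & Hk & H).
  assert (Hc : forall a b, uconn E a b -> omega xstar a = omega xstar b).
  { intros a b Hab. induction Hab as [|a b c Hab _ IH|a b c Hab _ IH]; auto;
    apply He in Hab; simpl in Hab; lra. }
  rewrite (Hc j k); [|apply HG; auto]. apply (H (xs xstar k)).
  intros i Hi. symmetry. apply (Hx k Hk i Hi).
Qed.

Lemma balance_star j : (j < nN)%nat -> power_balance xstar j = 0.
Proof. intros Hj. apply equilibrium_iff_balance; auto. apply omega_star_zero. Qed.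

(** Summation by parts: an edge leaves its tail and enters its head. For [w] the frequencies of [y],
    the edge sum is the rate of change of the edge energies, hence the cancellation in
    [energy_rate_le]. *)
Lemma power_balance_sum y (w : nat -> R) :
  sum_lt nN (fun j => w j * (power_balance y j - power_balance xstar j)) =
  sum_lt nN (fun j => w j * (g j (xs y j) (- omega y j) - g j (xs xstar j) 0))
  - sumL (fun e => (w (fst e) - w (snd e)) * (B e * (sin (eta y e) - sin (eta xstar e)))) E.
Proof.
  set (F := fun e => B e * (sin (eta y e) - sin (eta xstar e))).
  assert (Hsplit : forall P,
    sumL (fun e => B e * sin (eta y e)) (filter P E)
    - sumL (fun e => B e * sin (eta xstar e)) (filter P E) = sumL F (filter P E)).
  { intros P. rewrite <- sumL_minus. apply sumL_ext. intros; unfold F; ring. }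
  transitivity (sum_lt nN (fun j => w j * (g j (xs y j) (- omega y j) - g j (xs xstar j) 0))
    - (sum_lt nN (fun j => w j * sumL F (filter (fun e => Nat.eqb (fst e) j) E))
       - sum_lt nN (fun j => w j * sumL F (filter (fun e => Nat.eqb (snd e) j) E)))).
  - unfold sum_lt. rewrite <- !sumL_minus. apply sumL_ext. intros j Hj. apply in_seq0 in Hj.
    rewrite <- !Hsplit. unfold power_balance, flow_in, flow_out.
    rewrite (omega_star_zero j), Ropp_0 by auto. unfold edge. ring.
  - f_equal. rewrite (sum_by_key fst w F), (sum_by_key snd w F) by apply edge_ends.
    rewrite <- sumL_minus. apply sumL_ext. intros; unfold F; ring.
Qed.

(** Storage rate minus supply rate in the passivity inequality; the supply has the opposite sign
    here because the input is - omega_j. Passivity bounds it by minus phi_j at - omega_j. *)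
Definition dissipation (dV : nat -> vec -> vec) (y : state) (j : nat) : R :=
  sum_lt (nd j) (fun i => dV j (xs y j) i * f j (xs y j) (- omega y j) i)
  + omega y j * (g j (xs y j) (- omega y j) - g j (xs xstar j) 0).

Definition energy (V : nat -> vec -> R) (y : state) : R :=
  sumL (fun e => edge_energy (B e) (eta xstar e) (eta y e)) E
  + sum_lt nN (fun j => M j / 2 * (omega y j * omega y j))
  + sum_lt nN (fun j => V j (xs y j) - V j (xs xstar j)).

(** Of the passivity inequality only signs are kept, so phi_j disappears from here on. The ball is
    closed, ready for compactness. *)
Definition passive_ball (V : nat -> vec -> R) (dV : nat -> vec -> vec) (r : R) : Prop :=
  (forall j, (j < nN)%nat -> is_C1 (nd j) (V j) (dV j)) /\
  forall y, dist y xstar <= r ->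
    (forall e, In e E -> Rabs (eta y e) < PI / 2) /\
    forall j, (j < nN)%nat ->
      dissipation dV y j <= 0 /\ (omega y j <> 0 -> dissipation dV y j < 0) /\
      (0 < vnorm (nd j) (vsub (xs y j) (xs xstar j)) -> V j (xs xstar j) < V j (xs y j)).

Lemma passive_ball_exists :
  (forall j, (j < nN)%nat -> exists (V : vec -> R) (dV : vec -> vec),
            LISP_storage (nd j) (f j) (g j) 0 (xs xstar j) V dV /\
            strict_local_min (nd j) V (xs xstar j)) ->
  exists V dV r, 0 < r /\ passive_ball V dV r.
Proof.
  intros HA3.
  (* [functional_choice] needs a value at every natural number; indices that are not buses get a
     dummy pair. *)
  assert (Hch : forall j, exists VdV : (vec -> R) * (vec -> vec), (j < nN)%nat ->
    LISP_storage (nd j) (f j) (g j) 0 (xs xstar j) (fst VdV) (snd VdV) /\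
    strict_local_min (nd j) (fst VdV) (xs xstar j)).
  { intros j. destruct (Compare_dec.le_lt_dec nN j) as [Hj|Hj].
    - exists (fun _ => 0, fun v => v). intros Hj'. lia.
    - destruct (HA3 j Hj) as (V & dV & H). exists (V, dV). auto. }
  apply functional_choice in Hch. destruct Hch as (VdV & H).
  set (V := fun j => fst (VdV j)). set (dV := fun j => snd (VdV j)).
  destruct (finite_radius E (fun e r => forall y, dist y xstar <= r -> Rabs (eta y e) < PI / 2))
    as (r1 & Hr1 & H1).
  { intros e r r' Hr Hr' y Hy. apply Hr. lra. }
  { intros e He. specialize (HA4 e He). exists ((PI / 2 - Rabs (eta xstar e)) / 2).
    split; [lra|]. intros y Hy. pose proof (sdist_eta nN E nd y xstar e He).
    replace (eta y e) with ((eta y e - eta xstar e) + eta xstar e) by ring.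
    eapply Rle_lt_trans; [apply Rabs_triang|]. lra. }
  destruct (finite_radius (seq 0 nN) (fun j r => forall y, dist y xstar <= r ->
      dissipation dV y j <= 0 /\ (omega y j <> 0 -> dissipation dV y j < 0) /\
      (0 < vnorm (nd j) (vsub (xs y j) (xs xstar j)) -> V j (xs xstar j) < V j (xs y j))))
    as (r2 & Hr2 & H2).
  { intros j r r' Hr Hr' y Hy. apply Hr. lra. }
  { intros j Hj. apply in_seq0 in Hj.
    destruct (H j Hj) as [(Om & X & phi & HOm & HOm0 & HX & HX0 & _ & _ & Hphi & Hp) (d & Hdp & Hmin)].
    destruct (HOm 0 HOm0) as (d1 & Hd1 & HO). destruct (HX _ HX0) as (d2 & Hd2 & HX').
    (* Halving places the closed ball inside the open neighborhoods. *)
    exists (Rmin (d / 2) (Rmin (d1 / 2) (d2 / 2))). split; [repeat apply Rmin_pos; lra|].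
    intros y Hy. pose proof (Rmin_l (d / 2) (Rmin (d1 / 2) (d2 / 2))).
    pose proof (Rmin_r (d / 2) (Rmin (d1 / 2) (d2 / 2))).
    pose proof (Rmin_l (d1 / 2) (d2 / 2)). pose proof (Rmin_r (d1 / 2) (d2 / 2)).
    pose proof (sdist_om nN E nd y xstar j Hj) as Ho. pose proof (sdist_xs nN E nd y xstar j Hj) as Hx.
    rewrite omega_star_zero, Rminus_0_r in Ho by auto.
    assert (Hpy := Hp (- omega y j) (xs y j)).
    specialize (Hpy ltac:(apply HO; rewrite Rminus_0_r, Rabs_Ropp; lra) ltac:(apply HX'; lra)).
    rewrite Rminus_0_r in Hpy. destruct Hphi as [Hphi0 Hphi].
    unfold dissipation, dV.
    set (S := sum_lt (nd j) _) in *.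
    repeat split.
    - destruct (Req_dec (- omega y j) 0) as [Hz|Hz].
      + rewrite Hz, Hphi0 in Hpy. replace (omega y j) with 0 by lra. lra.
      + specialize (Hphi _ Hz). lra.
    - intros Hz. specialize (Hphi (- omega y j) ltac:(lra)). lra.
    - intros Hv. apply Hmin. lra. }
  exists V, dV, (Rmin r1 r2). pose proof (Rmin_l r1 r2). pose proof (Rmin_r r1 r2).
  split; [apply Rmin_pos; auto|]. split.
  - intros j Hj. destruct (H j Hj) as [(Om & X & phi & _ & _ & _ & _ & HC1 & _) _]. exact HC1.
  - intros y Hy. split; [intros; apply H1; auto; lra|]. intros j Hj. apply H2; [now apply in_seq0|lra].
Qed.

Context (V : nat -> vec -> R) (dV : nat -> vec -> vec) (r : R)
  (Hr : 0 < r) (Hpb : passive_ball V dV r).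

Lemma scont_dissipation : scont nN E nd (fun y => sum_lt nN (dissipation dV y)).
Proof.
  apply (scont_sum nN E nd (seq 0 nN) (fun j y => dissipation dV y j)).
  intros j Hj. apply in_seq0 in Hj.
  apply scont_plus.
  - apply (scont_sum nN E nd (seq 0 (nd j))
      (fun i y => dV j (xs y j) i * f j (xs y j) (- omega y j) i)).
    intros i Hi. apply in_seq0 in Hi. apply scont_mult; [|apply scont_f; auto].
    apply (scont_xs nN E nd (fun v => dV j v i)); auto.
    intros x eps He. apply (proj2 (proj1 Hpb j Hj)); auto.
  - apply scont_mult; [now apply scont_om|]. apply scont_minus; [apply scont_g; auto|apply scont_const].
Qed.

Lemma scont_energy : scont nN E nd (energy V).
Proof.
  apply scont_plus; [apply scont_plus|].
  - apply (scont_sum nN E nd E (fun e y => edge_energy (B e) (eta xstar e) (eta y e))).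
    intros e He. apply (scont_comp _ _ _ (edge_energy (B e) (eta xstar e))); [|now apply scont_eta].
    exact (derivable_continuity _ _ (derivable_edge_energy (B e) (eta xstar e))).
  - apply (scont_sum nN E nd (seq 0 nN) (fun j y => M j / 2 * (omega y j * omega y j))).
    intros j Hj. apply in_seq0 in Hj. apply scont_mult; [apply scont_const|].
    apply scont_mult; now apply scont_om.
  - apply (scont_sum nN E nd (seq 0 nN) (fun j y => V j (xs y j) - V j (xs xstar j))).
    intros j Hj. apply in_seq0 in Hj. apply scont_minus; [|apply scont_const].
    apply scont_xs; auto. intros x eps He. apply (C1_cont _ _ (dV j)); auto. apply Hpb; auto.
Qed.

Lemma energy_star : energy V xstar = 0.
Proof.
  unfold energy, sum_lt. rewrite !sumL_zero.
  - ring.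
  - intros; ring.
  - intros j Hj. apply in_seq0 in Hj. rewrite omega_star_zero; auto. ring.
  - intros. rewrite edge_energy_refl. ring.
Qed.

Lemma energy_terms_nonneg y : dist y xstar <= r ->
  (forall e, In e E -> 0 <= edge_energy (B e) (eta xstar e) (eta y e)) /\
  (forall j, In j (seq 0 nN) -> 0 <= M j / 2 * (omega y j * omega y j)) /\
  (forall j, In j (seq 0 nN) -> 0 <= V j (xs y j) - V j (xs xstar j)).
Proof.
  intros Hy. destruct (proj2 Hpb y Hy) as [He Hj]. repeat split.
  - intros e Hin. destruct (Req_dec (eta y e) (eta xstar e)) as [->|Hn].
    + rewrite edge_energy_refl. lra.
    + left. apply edge_energy_pos; auto.
  - intros j Hin. apply in_seq0 in Hin. specialize (HM j Hin).
    apply Rmult_le_pos; [lra|apply Rle_0_sqr].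
  - intros j Hin. apply in_seq0 in Hin. destruct (Hj j Hin) as (_ & _ & Hmin).
    destruct (vnorm_nonneg (nd j) (vsub (xs y j) (xs xstar j))) as [Hp|Hz].
    + specialize (Hmin Hp). lra.
    (* At distance 0 the two vectors may still differ beyond [nd j], which [V j] does not see. *)
    + rewrite (C1_ext (nd j) (V j) (dV j) (xs y j) (xs xstar j)); [lra|apply Hpb; auto|].
      intros i Hi. pose proof (vnorm_elem (nd j) (vsub (xs y j) (xs xstar j)) i Hi) as Hle.
      rewrite <- Hz in Hle. unfold vsub in Hle.
      pose proof (Rabs_pos (xs y j i - xs xstar j i)).
      destruct (Req_dec (xs y j i - xs xstar j i) 0) as [|Hn]; [lra|].
      apply Rabs_pos_lt in Hn. lra.
Qed.

Lemma energy_nonneg y : dist y xstar <= r -> 0 <= energy V y.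
Proof.
  intros Hy. destruct (energy_terms_nonneg y Hy) as (H1 & H2 & H3).
  pose proof (sumL_nonneg _ _ H1). pose proof (sumL_nonneg _ _ H2).
  pose proof (sumL_nonneg _ _ H3). unfold energy, sum_lt. lra.
Qed.

Lemma energy_pos y : 0 < dist y xstar <= r -> 0 < energy V y.
Proof.
  intros [Hpos Hy]. apply Rnot_le_lt. intros Hle.
  destruct (energy_terms_nonneg y Hy) as (H1 & H2 & H3).
  destruct (proj2 Hpb y Hy) as [He Hj].
  pose proof (sumL_nonneg _ _ H1). pose proof (sumL_nonneg _ _ H2). pose proof (sumL_nonneg _ _ H3).
  unfold energy, sum_lt in Hle.
  assert (Hz : dist y xstar = 0); [|lra].
  rewrite sdist_coords. apply sumL_zero, in_coords_inv.
  - intros e Hin. simpl. destruct (Req_dec (eta y e) (eta xstar e)) as [->|Hn].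
    + rewrite Rminus_diag. apply Rabs_R0.
    + pose proof (sumL_elem_le _ _ e H1 Hin).
      pose proof (edge_energy_pos (B e) (eta xstar e) (eta y e) (HB e Hin) (HA4 e Hin) (He e Hin) Hn).
      lra.
  - intros j Hin. simpl. apply in_seq0 in Hin. pose proof (sumL_elem_le _ _ j H2 Hin).
    apply in_seq0 in Hin. rewrite omega_star_zero, Rminus_0_r by auto. specialize (HM j Hin).
    destruct (Req_dec (omega y j) 0) as [->|Hn]; [apply Rabs_R0|].
    assert (0 < omega y j * omega y j) by (apply (Rlt_0_sqr _ Hn)). nra.
  - intros j i Hin Hi. simpl. apply in_seq0 in Hin. pose proof (sumL_elem_le _ _ j H3 Hin).
    apply in_seq0 in Hin. destruct (Hj j Hin) as (_ & _ & Hmin).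
    pose proof (vnorm_elem (nd j) (vsub (xs y j) (xs xstar j)) i Hi) as Hel.
    unfold vsub at 1 in Hel. pose proof (Rabs_pos (xs y j i - xs xstar j i)).
    destruct (vnorm_nonneg (nd j) (vsub (xs y j) (xs xstar j))) as [Hp|Hz0].
    + specialize (Hmin Hp). simpl in *. lra.
    + lra.
Qed.

(** Compactness of the sphere turns pointwise positivity of the energy into a level [m] that a
    solution would have to reach before leaving the ball. *)
Lemma energy_barrier : exists m, 0 < m /\ forall y, dist y xstar = r -> m <= energy V y.
Proof.
  destruct (scont_neg_bound nN E nd (fun y => 0 - energy V y) (fun y => dist y xstar = r) xstar r)
    as (m & Hm & H).
  - apply scont_minus; [apply scont_const|apply scont_energy].
  - intros; lra.
  - intros u p Hu Hp. apply Rle_antisym.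
    + apply (sconv_sdist_le nN E nd u); auto. intros n; specialize (Hu n); lra.
    + apply (sconv_sdist_ge nN E nd u); auto. intros n; specialize (Hu n); lra.
  - intros y Hy. pose proof (energy_pos y ltac:(lra)). lra.
  - exists m. split; auto. intros y Hy. specialize (H y Hy). lra.
Qed.

Lemma dissipation_nonpos y : dist y xstar <= r -> sum_lt nN (dissipation dV y) <= 0.
Proof.
  intros Hy. replace 0 with (INR (length (seq 0 nN)) * 0) by ring.
  apply sumL_bound. intros j Hj. apply (proj2 Hpb y Hy). now apply in_seq0.
Qed.

Lemma dissipation_uniform j eps : (j < nN)%nat -> 0 < eps ->
  exists c, 0 < c /\ forall y, dist y xstar <= r -> eps <= Rabs (omega y j) ->
    sum_lt nN (dissipation dV y) <= - c.
Proof.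
  intros Hj He.
  destruct (scont_neg_bound nN E nd (fun y => sum_lt nN (dissipation dV y))
    (fun y => dist y xstar <= r /\ eps <= Rabs (omega y j)) xstar r) as (c & Hc & H).
  - apply scont_dissipation.
  - tauto.
  - intros u p Hu Hp. split.
    + apply (sconv_sdist_le nN E nd u); auto. apply Hu.
    + assert (HF : scont nN E nd (fun y => Rabs (omega y j))).
      { apply (scont_comp _ _ _ Rabs); [apply Rcontinuity_abs|now apply scont_om]. }
      apply Rnot_lt_le. intros Hlt. destruct (HF u p Hp (eps - Rabs (omega p j))) as (N & HN); [lra|].
      specialize (HN N (le_n N)). unfold R_dist in HN. apply Rabs_def2 in HN.
      destruct (Hu N). lra.
  - intros y [Hy Hom]. pose proof (proj2 (proj2 Hpb y Hy)) as Hdis.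
    apply Rle_lt_trans with (dissipation dV y j).
    + apply (sumL_le_elem (dissipation dV y)); [|now apply in_seq0].
      intros k Hk. apply Hdis. now apply in_seq0.
    + apply Hdis; auto. intros Hz. rewrite Hz, Rabs_R0 in Hom. lra.
  - exists c. split; auto.
Qed.

(** * A Filippov solution: energy decay, trapping, vanishing frequencies *)

Context (x dx : R -> state) (Z : R -> Prop) (HZ : null_set Z)
  (Hac : abs_cont_traj nN E nd x)
  (Hdx : forall t, 0 <= t -> ~ Z t -> has_deriv nN E nd x t (dx t) /\ Q (x t) (dx t)).

Lemma traj_ACD c : In c (coords nN E nd) -> ACD Z (fun t => val (x t) c) (fun t => val (dx t) c).
Proof.
  intros Hc. split.
  - intros t _. exists 1. split; [lra|]. intros a b Ha _ Hab _.
    destruct (Hac a b Ha Hab) as (H1 & H2 & H3). revert c Hc.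
    apply in_coords_inv; intros; simpl; auto.
  - intros t Ht Hz. destruct (Hdx t Ht Hz) as [(H1 & H2 & H3) _]. revert c Hc.
    apply in_coords_inv; intros; simpl; auto.
Qed.

Lemma omega_ACD j : (j < nN)%nat -> ACD Z (fun t => omega (x t) j) (fun t => omega (dx t) j).
Proof. intros H. apply (traj_ACD (Com j)). now apply in_coords_om. Qed.

Lemma eta_ACD e : In e E -> ACD Z (fun t => eta (x t) e) (fun t => eta (dx t) e).
Proof. intros H. apply (traj_ACD (Ceta e)). now apply in_coords_eta. Qed.

Lemma xs_ACD j i : (j < nN)%nat -> (i < nd j)%nat ->
  ACD Z (fun t => xs (x t) j i) (fun t => xs (dx t) j i).
Proof. intros H Hi. apply (traj_ACD (Cxs j i)). now apply in_coords_xs. Qed.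

Definition energy_rate (t : R) : R :=
  sumL (fun e => B e * (sin (eta (x t) e) - sin (eta xstar e)) * eta (dx t) e) E
  + sum_lt nN (fun j => M j * (omega (x t) j * omega (dx t) j))
  + sum_lt nN (fun j => sum_lt (nd j) (fun i => dV j (xs (x t) j) i * xs (dx t) j i)).

Lemma energy_ACD : ACD Z (fun t => energy V (x t)) energy_rate.
Proof.
  apply ACD_plus; [apply ACD_plus|].
  - apply (ACD_sum Z E (fun e t => edge_energy (B e) (eta xstar e) (eta (x t) e))
      (fun e t => B e * (sin (eta (x t) e) - sin (eta xstar e)) * eta (dx t) e)).
    intros e He.
    apply (ACD_comp Z (edge_energy (B e) (eta xstar e))
      (fun h => B e * (sin h - sin (eta xstar e))) _ _ (derivable_edge_energy _ _)).
    + intros h. apply continuity_pt_mult; [now apply continuity_pt_const|].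
      apply continuity_pt_minus; [apply continuity_sin|now apply continuity_pt_const].
    + now apply eta_ACD.
  - apply (ACD_sum Z (seq 0 nN) (fun j t => M j / 2 * (omega (x t) j * omega (x t) j))
      (fun j t => M j * (omega (x t) j * omega (dx t) j))).
    intros j Hj. apply in_seq0 in Hj. pose proof (omega_ACD j Hj) as Ho.
    eapply ACD_ext; [| |apply (ACD_scal Z (M j / 2) _ _ (ACD_mult Z _ _ _ _ Ho Ho))].
    + reflexivity.
    + intros; simpl. field.
  - apply (ACD_sum Z (seq 0 nN) (fun j t => V j (xs (x t) j) - V j (xs xstar j))
      (fun j t => sum_lt (nd j) (fun i => dV j (xs (x t) j) i * xs (dx t) j i))).
    intros j Hj. apply in_seq0 in Hj.
    eapply ACD_ext; [| |apply (ACD_minus Z _ _ _ _ (ACD_C1 Z (nd j) (V j) (dV j)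
      (fun t => xs (x t) j) (fun t => xs (dx t) j) (proj1 Hpb j Hj) (fun i => xs_ACD j i Hj))
      (ACD_const Z (V j (xs xstar j))))].
    + reflexivity.
    + intros; simpl. ring.
Qed.

(* The edge terms cancel by summation by parts, and the loads only dissipate: [omega * v >= 0]. *)
Lemma energy_rate_le t : 0 <= t -> ~ Z t -> energy_rate t <= sum_lt nN (dissipation dV (x t)).
Proof.
  intros Ht Hz. destruct (Hdx t Ht Hz) as [_ (He & Ho & Hx)]. unfold energy_rate.
  pose proof (power_balance_sum (x t) (omega (x t))) as Hsum.
  rewrite (sumL_ext _ (fun e => (omega (x t) (fst e) - omega (x t) (snd e)) *
    (B e * (sin (eta (x t) e) - sin (eta xstar e))))).
  2:{ intros [a b] Hab. simpl. rewrite He by auto. ring. }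
  assert (H1 : sum_lt nN (fun j => M j * (omega (x t) j * omega (dx t) j)) <=
    sum_lt nN (fun j => omega (x t) j * (power_balance (x t) j - power_balance xstar j))).
  { apply sumL_le. intros j Hj. apply in_seq0 in Hj. destruct (Ho j Hj) as (v & Hv & ->).
    apply Fdc_passive in Hv; auto. rewrite balance_star by auto. unfold power_balance.
    specialize (HM j Hj). match goal with |- M j * (?o * (/ M j * ?q)) <= _ =>
      replace (M j * (o * (/ M j * q))) with (o * q) by (field; lra) end. lra. }
  assert (H2 : sum_lt nN (fun j => sum_lt (nd j) (fun i => dV j (xs (x t) j) i * xs (dx t) j i)) =
    sum_lt nN (fun j => sum_lt (nd j) (fun i => dV j (xs (x t) j) i * f j (xs (x t) j) (- omega (x t) j) i))).
  { apply sumL_ext. intros j Hj. apply in_seq0 in Hj. apply sumL_ext. intros i Hi.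
    apply in_seq0 in Hi. rewrite Hx; auto. }
  assert (H3 : sum_lt nN (dissipation dV (x t)) =
    sum_lt nN (fun j => sum_lt (nd j) (fun i => dV j (xs (x t) j) i * f j (xs (x t) j) (- omega (x t) j) i))
    + sum_lt nN (fun j => omega (x t) j * (g j (xs (x t) j) (- omega (x t) j) - g j (xs xstar j) 0))).
  { unfold sum_lt. rewrite <- sumL_plus. reflexivity. }
  lra.
Qed.

Lemma traj_cont t : 0 <= t -> forall eps, 0 < eps ->
  exists d, 0 < d /\ forall s, 0 <= s -> Rabs (s - t) < d -> dist (x s) (x t) < eps.
Proof.
  intros Ht eps He. set (N := INR (length (coords nN E nd))).
  assert (HN : 0 <= N) by apply pos_INR.
  assert (Hq : 0 < eps / (N + 1)) by (apply Rdiv_lt_0_compat; lra).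
  destruct (finite_radius (coords nN E nd) (fun c d => forall s, 0 <= s -> Rabs (s - t) < d ->
    Rabs (val (x s) c - val (x t) c) < eps / (N + 1))) as (d & Hdp & H).
  { intros c a b Ha Hb s Hs Hst. apply Ha; auto. lra. }
  { intros c Hc. apply (ACD_cont _ _ _ t (traj_ACD c Hc)); auto. }
  exists d. split; auto. intros s Hs Hst. rewrite sdist_coords.
  eapply Rle_lt_trans; [apply (sumL_bound _ _ (eps / (N + 1)))|].
  - intros c Hc. left. apply H; auto.
  - fold N. apply Rlt_le_trans with ((N + 1) * (eps / (N + 1))).
    + apply Rmult_lt_compat_r; lra.
    + right. field. lra.
Qed.

(** If the solution is inside the ball before time [s], continuity puts it in the closed ball at
    [s]. The energy has not increased on the way, so it is below [m] and the sphere is excluded. *)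
Lemma trapped m : (forall y, dist y xstar = r -> m <= energy V y) ->
  dist (x 0) xstar < r -> energy V (x 0) < m -> forall t, 0 <= t -> dist (x t) xstar < r.
Proof.
  intros Hm H0 HW t Ht. apply (real_induction 0 t (fun s => dist (x s) xstar < r)); auto; [| |lra].
  - intros s Hs Hin. destruct (traj_cont s ltac:(lra) (r - dist (x s) xstar)) as (d & Hdp & H); [lra|].
    exists d. split; auto. intros u Hu _. specialize (H u ltac:(lra)).
    rewrite Rabs_pos_eq in H by lra. specialize (H ltac:(lra)).
    pose proof (sdist_triang nN E nd (x u) (x s) xstar). lra.
  - intros s Hs Hin.
    assert (Hle : dist (x s) xstar <= r).
    { apply Rnot_lt_le. intros Hlt.
      destruct (traj_cont s ltac:(lra) (dist (x s) xstar - r)) as (d & Hdp & H); [lra|].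
      set (u := Rmax 0 (s - d / 2)).
      assert (Hu : 0 <= u /\ s - d < u < s).
      { unfold u, Rmax; destruct (Rle_dec _ _); lra. }
      specialize (H u ltac:(lra) ltac:(apply Rabs_def1; lra)). specialize (Hin u ltac:(lra)).
      pose proof (sdist_triang nN E nd (x s) (x u) xstar).
      rewrite (sdist_sym nN E nd (x s) (x u)) in *. lra. }
    pose proof (ACD_growth Z _ _ 0 s 0 HZ energy_ACD ltac:(lra) ltac:(lra)) as HWs.
    assert (Hdec : energy V (x s) - energy V (x 0) <= 0 * (s - 0)).
    { apply HWs. intros u Hu Hz. eapply Rle_trans; [apply energy_rate_le; auto; lra|].
      apply dissipation_nonpos. destruct (Req_dec u s) as [->|]; auto. left; apply Hin; lra. }
    destruct (Req_dec (dist (x s) xstar) r) as [Hr0|]; [|lra].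
    apply Hm in Hr0. lra.
Qed.

Context (Hin : forall t, 0 <= t -> dist (x t) xstar <= r).

(** The loads are discontinuous but bounded, and everything else is continuous on the closed
    ball. *)
Lemma velocity_bounded c : In c (coords nN E nd) ->
  exists K, forall t, 0 <= t -> ~ Z t -> Rabs (val (dx t) c) <= K.
Proof.
  revert c. apply in_coords_inv.
  - intros [i j] He. destruct (edge_ends (i, j) He) as [Hi Hj]. simpl in Hi, Hj.
    destruct (scont_bounded nN E nd (fun y => omega y i - omega y j) xstar r) as (K & HK).
    { apply scont_minus; now apply scont_om. }
    exists K. intros t Ht Hz. simpl. destruct (Hdx t Ht Hz) as [_ (Hq & _)]. rewrite Hq; auto.
  - intros j Hj.
    destruct (scont_bounded nN E nd (fun y => power_balance y j) xstar r (scont_power_balance j Hj)) as (K & HK).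
    exists (/ M j * (K + (dhi j - dlo j))). intros t Ht Hz. simpl.
    destruct (Hdx t Ht Hz) as [_ (_ & Hq & _)]. destruct (Hq j Hj) as (v & Hv & ->).
    apply Fdc_bound in Hv; auto. specialize (HK (x t) (Hin t Ht)). specialize (HM j Hj).
    assert (0 < / M j) by now apply Rinv_0_lt_compat.
    rewrite Rabs_mult, (Rabs_pos_eq (/ M j)) by lra. apply Rmult_le_compat_l; [lra|].
    replace (_ - v - _ + _) with (power_balance (x t) j + - v) by (unfold power_balance; ring).
    eapply Rle_trans; [apply Rabs_triang|]. rewrite Rabs_Ropp. lra.
  - intros j i Hj Hi.
    destruct (scont_bounded nN E nd _ xstar r (scont_f nN E nd (f j) j i Hj Hi (Hf j Hj))) as (K & HK).
    exists K. intros t Ht Hz. simpl. destruct (Hdx t Ht Hz) as [_ (_ & _ & Hq)].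
    rewrite Hq by auto. apply HK; auto.
Qed.

Lemma traj_lipschitz : exists K, 0 < K /\
  forall a b, 0 <= a -> a <= b -> dist (x b) (x a) <= K * (b - a).
Proof.
  destruct (finite_bound (coords nN E nd) (fun c K => forall t, 0 <= t -> ~ Z t ->
    Rabs (val (dx t) c) <= K)) as (K & HK & H).
  { intros c K K' H HKK t Ht Hz. specialize (H t Ht Hz). lra. }
  { apply velocity_bounded. }
  set (N := INR (length (coords nN E nd))). assert (HN : 0 <= N) by apply pos_INR.
  exists ((N + 1) * K). split; [nra|]. intros a b Ha Hab. rewrite sdist_coords.
  apply Rle_trans with (N * (K * (b - a))).
  - apply sumL_bound. intros c Hc.
    assert (Hb : forall t, 0 <= t -> ~ Z t -> - K <= val (dx t) c <= K).
    { intros t Ht Hz. specialize (H c Hc t Ht Hz). pose proof (Rle_abs (val (dx t) c)).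
      pose proof (Rle_abs (- val (dx t) c)) as H1. rewrite Rabs_Ropp in H1. lra. }
    pose proof (ACD_growth Z _ _ a b K HZ (traj_ACD c Hc) Ha Hab) as H1.
    pose proof (ACD_growth_ge Z _ _ a b (- K) HZ (traj_ACD c Hc) Ha Hab) as H2.
    apply Rabs_le. split.
    + assert (- K * (b - a) <= val (x b) c - val (x a) c); [|lra].
      apply H2. intros t Ht Hz. apply Hb; auto; lra.
    + apply H1. intros t Ht Hz. apply Hb; auto; lra.
  - assert (0 <= K * (b - a)) by (apply Rmult_le_pos; lra). nra.
Qed.

(** The trajectory is Lipschitz in time, so wherever [Rabs (omega j)] reaches [eps] it stays above
    eps / 2 for a time [tau], at an energy cost of at least [c * tau]. The energy is nonnegative and
    cannot pay this arbitrarily late. *)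
Lemma omega_to_zero j : (j < nN)%nat -> forall eps, 0 < eps ->
  exists T, 0 <= T /\ forall t, T <= t -> Rabs (omega (x t) j) < eps.
Proof.
  intros Hj eps He. apply NNPP. intros Hn.
  assert (Hbad : forall T, 0 <= T -> exists t, T <= t /\ eps <= Rabs (omega (x t) j)).
  { intros T HT. apply NNPP. intros Hk. apply Hn. exists T. split; auto. intros t Ht.
    apply Rnot_le_lt. intros Hle. apply Hk. exists t; auto. }
  destruct traj_lipschitz as (K & HK & Hlip).
  destruct (dissipation_uniform j (eps / 2) Hj ltac:(lra)) as (c & Hc & Hdis).
  (* During [tau] the state moves by at most eps / 2. *)
  set (tau := eps / (2 * K)). assert (Htau : 0 < tau) by (apply Rdiv_lt_0_compat; lra).
  assert (HKtau : K * tau = eps / 2) by (unfold tau; field; lra).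
  assert (Hdrop : forall t, 0 <= t -> eps <= Rabs (omega (x t) j) ->
    energy V (x (t + tau)) - energy V (x t) <= - c * tau).
  { intros t Ht Hbig. replace tau with (t + tau - t) at 2 by ring.
    apply (ACD_growth Z _ _ _ _ _ HZ energy_ACD); [lra|lra|]. intros s Hs Hz.
    eapply Rle_trans; [apply energy_rate_le; auto; lra|]. apply Hdis; [apply Hin; lra|].
    pose proof (Hlip t s Ht ltac:(lra)) as Hd1. pose proof (sdist_om nN E nd (x s) (x t) j Hj) as Hd2.
    assert (K * (s - t) <= eps / 2) by (rewrite <- HKtau; apply Rmult_le_compat_l; lra).
    pose proof (Rabs_triang_inv (omega (x t) j) (omega (x s) j)) as Hd3.
    rewrite Rabs_minus_sym in Hd3. lra. }
  assert (Hdec : forall a b, 0 <= a -> a <= b -> energy V (x b) <= energy V (x a)).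
  { intros a b Ha Hab. assert (energy V (x b) - energy V (x a) <= 0 * (b - a)); [|lra].
    apply (ACD_growth Z _ _ _ _ _ HZ energy_ACD); auto. intros s Hs Hz.
    eapply Rle_trans; [apply energy_rate_le; auto; lra|]. apply dissipation_nonpos. apply Hin; lra. }
  (* [l] is minus the infimum of the energy. One excursion after a time where the energy is within
     [c * tau] of the infimum would push it below, so excursions need not be counted. *)
  destruct (completeness (fun z => exists t, 0 <= t /\ z = - energy V (x t))) as (l & Hub & Hlub).
  { exists 0. intros z (t & Ht & ->). pose proof (energy_nonneg (x t) (Hin t Ht)). lra. }
  { exists (- energy V (x 0)), 0. split; [lra|reflexivity]. }
  assert (Hct : 0 < c * tau) by now apply Rmult_lt_0_compat.
  assert (Hnear : exists t0, 0 <= t0 /\ l - c * tau < - energy V (x t0)).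
  { apply NNPP. intros Hk. assert (l <= l - c * tau); [|lra]. apply Hlub.
    intros z (t & Ht & ->). apply Rnot_lt_le. intros Hlt. apply Hk. exists t; auto. }
  destruct Hnear as (t0 & Ht0 & Hl). destruct (Hbad t0 Ht0) as (t & Ht & Hbig).
  specialize (Hdrop t ltac:(lra) Hbig). specialize (Hdec t0 t Ht0 Ht).
  assert (- energy V (x (t + tau)) <= l).
  { apply Hub. exists (t + tau). split; [lra|reflexivity]. }
  lra.
Qed.

(** * Limit points of the trapped trajectory are equilibria *)

Definition limit_state (p : state) : Prop :=
  forall eps T, 0 < eps -> exists t, 0 <= t /\ T <= t /\ dist (x t) p < eps.

Lemma limit_omega p j : limit_state p -> (j < nN)%nat -> omega p j = 0.
Proof.
  intros Hp Hj. apply NNPP. intros Hn. apply Rabs_pos_lt in Hn.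
  destruct (omega_to_zero j Hj (Rabs (omega p j) / 2)) as (T & HT & H); [lra|].
  destruct (Hp (Rabs (omega p j) / 2) T) as (t & Ht0 & Ht & Hdp); [lra|]. specialize (H t Ht).
  pose proof (sdist_om nN E nd (x t) p j Hj) as Hs. rewrite Rabs_minus_sym in Hs.
  pose proof (Rabs_triang_inv (omega p j) (omega (x t) j)). lra.
Qed.

(* If the imbalance had sign [s] at [p], then [s * omega j] would grow by a fixed amount on a
   time interval of fixed length, arbitrarily late. *)
Lemma limit_balance_signed p j s : limit_state p -> (j < nN)%nat -> Rabs s = 1 ->
  s * power_balance p j <= 0.
Proof.
  intros Hp Hj Hs. apply Rnot_lt_le. intros Hpos.
  set (c := s * power_balance p j) in *.
  destruct (scont_eps nN E nd _ p (scont_power_balance j Hj) (c / 2)) as (rho & Hrho & Hnear); [lra|].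
  destruct traj_lipschitz as (K & HK & Hlip).
  (* In time [tau] the state moves by at most rho / 4, so from within rho / 2 of [p] it stays where
     the balance differs from that at [p] by less than c / 2. *)
  set (tau := rho / (4 * K)). assert (Htau : 0 < tau) by (apply Rdiv_lt_0_compat; lra).
  assert (HKtau : K * tau = rho / 4) by (unfold tau; field; lra).
  pose proof (HM j Hj) as HMj. assert (HiM : 0 < / M j) by now apply Rinv_0_lt_compat.
  set (gain := / M j * (c / 2) * tau).
  assert (Hgain : 0 < gain).
  { apply Rmult_lt_0_compat; [apply Rmult_lt_0_compat|]; lra. }
  (* The bound gain / 2 at both ends of the interval contradicts a growth by [gain]; the other two
     bounds keep omega_j in the dead band. *)
  set (eps := Rmin (gain / 2) (Rmin (whi j) (- wlo j))).
  assert (Heps : 0 < eps /\ eps <= gain / 2 /\ eps <= whi j /\ eps <= - wlo j).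
  { specialize (Hw j Hj). unfold eps.
    pose proof (Rmin_l (gain / 2) (Rmin (whi j) (- wlo j))).
    pose proof (Rmin_r (gain / 2) (Rmin (whi j) (- wlo j))).
    pose proof (Rmin_l (whi j) (- wlo j)). pose proof (Rmin_r (whi j) (- wlo j)).
    repeat split; try lra. repeat apply Rmin_pos; lra. }
  destruct (omega_to_zero j Hj eps) as (T & HT & Hsmall); [lra|].
  destruct (Hp (rho / 2) T) as (t & Ht0 & Ht & Hclose); [lra|].
  assert (Hgrow : / M j * (c / 2) * (t + tau - t) <= s * omega (x (t + tau)) j - s * omega (x t) j).
  { apply (ACD_growth_ge Z _ _ _ _ _ HZ (ACD_scal Z s _ _ (omega_ACD j Hj))); [lra|lra|].
    intros u Hu Hz. destruct (Hdx u ltac:(lra) Hz) as [_ (_ & Ho & _)].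
    destruct (Ho j Hj) as (v & Hv & ->).
    specialize (Hsmall u ltac:(lra)). apply Rabs_def2 in Hsmall.
    apply Fdc_dead_band in Hv; [|lra]. subst v.
    assert (Hd1 : dist (x u) p < rho).
    { pose proof (sdist_triang nN E nd (x u) (x t) p). pose proof (Hlip t u Ht0 ltac:(lra)).
      assert (K * (u - t) <= rho / 4) by (rewrite <- HKtau; apply Rmult_le_compat_l; lra). lra. }
    specialize (Hnear (x u) Hd1).
    replace (_ - 0 - _ + _) with (power_balance (x u) j) by (unfold power_balance; ring).
    replace (s * (/ M j * power_balance (x u) j)) with (/ M j * (s * power_balance (x u) j)) by ring.
    apply Rmult_le_compat_l; [lra|].
    assert (Hd2 : Rabs (s * power_balance p j - s * power_balance (x u) j) < c / 2).
    { rewrite <- Rmult_minus_distr_l, Rabs_mult, Hs, Rabs_minus_sym. lra. }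
    apply Rabs_def2 in Hd2. fold c in Hd2. lra. }
  assert (Hb : forall u, T <= u -> Rabs (s * omega (x u) j) < gain / 2).
  { intros u Hu. rewrite Rabs_mult, Hs. specialize (Hsmall u Hu). lra. }
  pose proof (Rabs_def2 _ _ (Hb t Ht)). pose proof (Rabs_def2 _ _ (Hb (t + tau) ltac:(lra))).
  replace (/ M j * (c / 2) * (t + tau - t)) with gain in Hgrow by (unfold gain; ring). lra.
Qed.

Lemma limit_balance p j : limit_state p -> (j < nN)%nat -> power_balance p j = 0.
Proof.
  intros Hp Hj.
  pose proof (limit_balance_signed p j 1 Hp Hj Rabs_R1).
  pose proof (limit_balance_signed p j (-1) Hp Hj ltac:(rewrite Rabs_left; lra)). lra.
Qed.

(** The limit set of the single component x_j^s, because (A1)(ii) is stated bus by bus. *)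
Definition xs_limit_set (j : nat) (v : vec) : Prop :=
  forall eps T, 0 < eps -> exists t, 0 <= t /\ T <= t /\ vnorm (nd j) (vsub (xs (x t) j) v) < eps.

Lemma xs_limit_compact j : (j < nN)%nat -> compactV (nd j) (xs_limit_set j).
Proof.
  intros Hj. split.
  - intros v Hv.
    assert (Hex : exists eps T, 0 < eps /\ forall t, 0 <= t -> T <= t ->
      eps <= vnorm (nd j) (vsub (xs (x t) j) v)).
    { apply NNPP. intros Hn. apply Hv. intros eps T He. apply NNPP. intros Hk. apply Hn.
      exists eps, T. split; auto. intros t Ht0 Ht. apply Rnot_lt_le. intros Hlt. apply Hk.
      exists t; auto. }
    destruct Hex as (eps & T & He & Hfar). exists (eps / 2). split; [lra|].
    intros w Hwv HSw. destruct (HSw (eps / 2) T) as (t & Ht0 & Ht & Hc); [lra|].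
    specialize (Hfar t Ht0 Ht). pose proof (vnorm_triang (nd j) (xs (x t) j) w v). lra.
  - exists (1 + (r + vnorm (nd j) (xs xstar j))). intros v Hv.
    destruct (Hv 1 0 Rlt_0_1) as (t & Ht0 & Ht & Hc).
    pose proof (sdist_xs nN E nd (x t) xstar j Hj). specialize (Hin t Ht0).
    assert (Hz : forall w, vnorm (nd j) (vsub w (fun _ => 0)) = vnorm (nd j) w).
    { intros w. apply vnorm_ext. intros; unfold vsub; ring. }
    pose proof (vnorm_triang (nd j) v (xs (x t) j) (fun _ => 0)).
    pose proof (vnorm_triang (nd j) (xs (x t) j) (xs xstar j) (fun _ => 0)).
    rewrite !Hz in *. rewrite (vnorm_sym (nd j) v) in *. lra.
Qed.

(** Late pieces of x_j^s almost solve the equation with input 0, with an error of at most a constant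
    times [Rabs (omega j)]. If such a piece is close to [phi 0] at a late time [s0], it is close to
    [phi t] at [s0 + t], for either sign of [t]. The input [- 0] matches (A1)(ii) at [wb = 0]. *)
Lemma xs_limit_invariant j : (j < nN)%nat ->
  invariant_set (nd j) (fun v => f j v (- 0)) (xs_limit_set j).
Proof.
  intros Hj phi Hphi H0 t eps T He.
  destruct (Hf j Hj) as (L & HL).
  assert (HL' : forall v w, vnorm (nd j) (vsub (f j v (- 0)) (f j w (- 0))) <= L * vnorm (nd j) (vsub v w)).
  { intros v w. specialize (HL v w (- 0) (- 0)). rewrite Rminus_diag, Rabs_R0, Rplus_0_r in HL. auto. }
  destruct (asymptotic_solution_close Z (nd j) (fun v => f j v (- 0)) phi (fun s => xs (x s) j)
    (fun s => xs (dx s) j) L t HZ Hphi HL' (fun i => xs_ACD j i Hj) eps He) as (e & Hep & Hclose).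
  set (L1 := Rmax L 0 + 1).
  assert (HL1 : L <= L1 /\ 1 <= L1) by (unfold L1, Rmax; destruct (Rle_dec _ _); lra).
  destruct (omega_to_zero j Hj (e / L1)) as (T1 & HT1 & Hsmall); [apply Rdiv_lt_0_compat; lra|].
  pose proof (Rabs_pos t) as Hat. pose proof (Rle_abs t) as Hat1. pose proof (Rle_abs (- t)) as Hat2.
  rewrite Rabs_Ropp in Hat2.
  (* The summand [Rabs t] puts the whole window between [s0] and [s0 + t] after both [T] and [T1],
     also for negative [t]. *)
  destruct (H0 e (Rmax T T1 + Rabs t)) as (s0 & Hs0 & Hs0T & Hs0c); auto.
  pose proof (Rmax_l T T1). pose proof (Rmax_r T T1).
  exists (s0 + t). repeat split; [lra|lra|].
  apply Hclose; [lra| |lra].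
  intros s Hs Hz. destruct (Hdx s ltac:(lra) Hz) as [_ (_ & _ & Hx)].
  rewrite (vnorm_ext (nd j) _ (vsub (f j (xs (x s) j) (- omega (x s) j)) (f j (xs (x s) j) (- 0)))).
  2:{ intros i Hi. unfold vsub. rewrite Hx; auto. }
  eapply Rle_trans; [apply HL|]. rewrite vnorm_refl, Rplus_0_l.
  replace (- omega (x s) j - - 0) with (- omega (x s) j) by ring. rewrite Rabs_Ropp.
  specialize (Hsmall s ltac:(lra)). pose proof (Rabs_pos (omega (x s) j)).
  apply Rle_trans with (L1 * (e / L1)); [|right; field; lra]. nra.
Qed.

Context
  (HA1ii : forall j, (j < nN)%nat -> forall wb : R, forall S : vec -> Prop,
            compactV (nd j) S -> invariant_set (nd j) (fun x => f j x (- wb)) S ->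
            forall x, S x -> forall i, (i < nd j)%nat -> f j x (- wb) i = 0).

Lemma limit_equilibrium p : limit_state p -> equilibrium p.
Proof.
  intros Hp. apply equilibrium_iff_balance; [intros; now apply limit_omega|].
  intros j Hj. split; [now apply limit_balance|]. rewrite limit_omega by auto.
  apply (HA1ii j Hj 0 (xs_limit_set j)).
  - now apply xs_limit_compact.
  - now apply xs_limit_invariant.
  - intros eps T He. destruct (Hp eps T He) as (t & Ht0 & Ht & Hc). exists t. repeat split; auto.
    eapply Rle_lt_trans; [apply (sdist_xs nN E nd); exact Hj|exact Hc].
Qed.

(** Arbitrarily late states at distance at least [eps] from all equilibria would, since the ball is
    bounded, accumulate at a limit state, which is an equilibrium. *)
Lemma converges_to_equilibria eps : 0 < eps ->
  exists T, forall t, T <= t -> exists xe, equilibrium xe /\ dist (x t) xe < eps.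
Proof.
  intros He. apply NNPP. intros Hn.
  assert (Hbad : forall k : nat, exists t, INR k <= t /\ forall xe, equilibrium xe -> eps <= dist (x t) xe).
  { intros k. apply NNPP. intros Hk. apply Hn. exists (INR k). intros t Ht. apply NNPP. intros Hm.
    apply Hk. exists t. split; auto. intros xe Hxe. apply Rnot_lt_le. intros Hlt.
    apply Hm. exists xe; auto. }
  apply functional_choice in Hbad. destruct Hbad as (tk & Htk).
  destruct (bounded_sconv_subseq nN E nd (fun k => x (tk k)) xstar r) as (s & p & Hs & Hp).
  { intros k. apply Hin. pose proof (pos_INR k). destruct (Htk k). lra. }
  assert (Hlim : limit_state p).
  { intros e T Hep. destruct (sconv_eps nN E nd _ p Hp e Hep) as (N & HN).
    destruct (INR_unbounded T) as (m & Hm). exists (tk (s (N + m)%nat)).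
    destruct (Htk (s (N + m)%nat)) as [Hk _]. specialize (Hs (N + m)%nat).
    assert (INR m <= INR (s (N + m)%nat)) by (apply le_INR; lia).
    pose proof (pos_INR (s (N + m)%nat)).
    repeat split; [lra|lra|]. apply HN. lia. }
  destruct (sconv_eps nN E nd _ p Hp eps He) as (N & HN). specialize (HN N (le_n N)).
  destruct (Htk (s N)) as [_ Hfar]. specialize (Hfar p (limit_equilibrium p Hlim)). lra.
Qed.

End Network.

Theorem theorem1
  (nN : nat) (E : list edge) (nd : nat -> nat)
  (M pL : nat -> R) (B : edge -> R)
  (f : nat -> vec -> R -> vec) (g : nat -> vec -> R -> R)
  (dlo dhi wlo whi : nat -> R)
  (HG : valid_graph nN E)
  (HM : forall j, (j < nN)%nat -> 0 < M j)
  (HB : forall e, In e E -> 0 < B e)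
  (Hd : forall j, (j < nN)%nat -> dlo j <= 0 <= dhi j)
  (Hw : forall j, (j < nN)%nat -> wlo j < 0 < whi j)
  (Hf : forall j, (j < nN)%nat -> globally_lipschitz_f (nd j) (f j))
  (Hg : forall j, (j < nN)%nat -> globally_lipschitz_g (nd j) (g j))
  (* (A1) *)
  (HA1i : forall j, (j < nN)%nat -> exists xb : vec,
            forall i, (i < nd j)%nat -> f j xb 0 i = 0)
  (HA1ii : forall j, (j < nN)%nat -> forall wb : R, forall S : vec -> Prop,
            compactV (nd j) S -> invariant_set (nd j) (fun x => f j x (- wb)) S ->
            forall x, S x -> forall i, (i < nd j)%nat -> f j x (- wb) i = 0)
  (* (A2) *)
  (HA2 : exists j, (j < nN)%nat /\ forall (xb : vec) (wb : R),
            (forall i, (i < nd j)%nat -> f j xb (- wb) i = 0) -> wb = 0)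
  (xstar : state)
  (Heq : is_equilibrium nN E nd M pL B f g dlo dhi wlo whi xstar)
  (* (A3) *)
  (HA3 : forall j, (j < nN)%nat -> exists (V : vec -> R) (dV : vec -> vec),
            LISP_storage (nd j) (f j) (g j) 0 (xs xstar j) V dV /\
            strict_local_min (nd j) V (xs xstar j))
  (* (A4) *)
  (HA4 : forall e, In e E -> Rabs (eta xstar e) < PI / 2) :
  exists Xi : state -> Prop,
    openS nN E nd Xi /\ Xi xstar /\
    forall x : R -> state,
      filippov_sol nN E nd M pL B f g dlo dhi wlo whi x -> Xi (x 0) ->
      (forall eps, 0 < eps -> exists T, forall t, T <= t ->
         exists xe, is_equilibrium nN E nd M pL B f g dlo dhi wlo whi xe /\
                    sdist nN E nd (x t) xe < eps) /\
      (forall eps, 0 < eps -> exists T, forall t, T <= t ->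
         forall j, (j < nN)%nat -> Rabs (omega (x t) j) < eps).
Proof.
  destruct (passive_ball_exists nN E nd M pL B f g dlo dhi wlo whi HG HA2 xstar Heq HA4 HA3)
    as (V & dV & r & Hr & Hpb).
  assert (HcontW : scont nN E nd (energy nN E M B xstar V)) by (eapply scont_energy; eassumption).
  assert (HW0 : energy nN E M B xstar V xstar = 0) by (eapply energy_star; eassumption).
  assert (Hbar : exists m, 0 < m /\
    forall y, sdist nN E nd y xstar = r -> m <= energy nN E M B xstar V y)
    by (eapply energy_barrier; eassumption).
  destruct Hbar as (m & Hm & Hbar).
  (* The sublevel set must be cut by the ball: outside it the energy may be small again. *)
  exists (fun y => sdist nN E nd y xstar < r /\ energy nN E M B xstar V y < m).
  split; [|split].
  - intros y [Hy1 Hy2].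
    destruct (scont_eps nN E nd _ y HcontW (m - energy nN E M B xstar V y)) as (d & Hdp & H); [lra|].
    exists (Rmin d (r - sdist nN E nd y xstar)). split; [apply Rmin_pos; lra|].
    intros z Hz. pose proof (Rmin_l d (r - sdist nN E nd y xstar)).
    pose proof (Rmin_r d (r - sdist nN E nd y xstar)).
    pose proof (sdist_triang nN E nd z y xstar). specialize (H z ltac:(lra)).
    apply Rabs_def2 in H. lra.
  - rewrite sdist_refl. lra.
  - intros x [Hac (Z & HZ & Hsol)] [Hx0 HWx0].
    (* A velocity is chosen at every real time; [zero_state] is the default at negative times and on
       [Z]. *)
    assert (Hch : forall t, exists dx, 0 <= t -> ~ Z t ->
      has_deriv nN E nd x t dx /\ Qmap nN E nd M pL B f g dlo dhi wlo whi (x t) dx).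
    { intros t. destruct (classic (0 <= t /\ ~ Z t)) as [[Ht Hz]|Hn].
      - destruct (Hsol t Ht Hz) as (dx & H). exists dx. auto.
      - exists zero_state. tauto. }
    apply functional_choice in Hch. destruct Hch as (dx & Hdx).
    assert (Hin : forall t, 0 <= t -> sdist nN E nd (x t) xstar <= r).
    { intros t Ht. left. revert t Ht. eapply trapped; eassumption. }
    split.
    + intros eps He. eapply converges_to_equilibria; eassumption.
    + intros eps He.
      destruct (finite_bound (seq 0 nN) (fun j T => forall t, T <= t -> Rabs (omega (x t) j) < eps))
        as (T & _ & HT).
      { intros j T T' H HTT t Ht. apply H. lra. }
      { intros j Hj. apply in_seq0 in Hj.
        assert (H : exists T, 0 <= T /\ forall t, T <= t -> Rabs (omega (x t) j) < eps)
          by (eapply omega_to_zero; eassumption).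
        destruct H as (T & _ & H). exists T. auto. }
      exists T. intros t Ht j Hj. apply HT; auto. now apply in_seq0.
Qed.
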